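(* Let $(F,s)$ be a $(\mathbb{C}^* )^4$-fixed $\mathrm{PT}_0$ pair on $\mathbb{C}^4$ with scheme-theoretic support $Z$. Let $Z_1\subset Z$ be the pure 2-dimensional part of $Z$, i.e. $\mathcal{O}_{Z_1}=\mathcal{O}_Z/T_1(\mathcal{O}_Z)$, and write $Z_1=\bigcup_{1\le a<b\le 4}Z_{\lambda_{ab}}$ for finite partitions $\boldsymbol\lambda=\{\lambda_{ab}\}_{1\le a<b\le4}$. Let $$W=(Z_{\lambda_{12}}\cup Z_{\lambda_{13}}\cup Z_{\lambda_{23}})\cap(Z_{\lambda_{14}}\cup Z_{\lambda_{24}}\cup Z_{\lambda_{34}})$$ (scheme-theoretic unions and intersection), and let $\mathfrak m\subset\mathcal{O}_Z$ be the ideal sheaf of the origin. (1) The induced sequence $$0\to\varinjlim_r\mathcal{H}om(\mathfrak m^r,T_1(\mathcal{O}_Z))\to\varinjlim_r\mathcal{H}om(\mathfrak m^r,\mathcal{O}_Z)\to\varinjlim_r\mathcal{H}om(\mathfrak m^r,\mathcal{O}_{Z_1})\to0$$ is exact, and there is a $(\mathbb{C}^* )^4$-equivariant isomorphism $\varinjlim_r\mathcal{H}om(\mathfrak m^r,\mathcal{O}_{Z_1})/\mathcal{O}_{Z_1}\cong T_0(\mathcal{O}_W)$. (2) Suppose $Z=Z_1$. Then the $(\mathbb{C}^* )^4$-fixed $\mathrm{PT}_0$ pairs on $\mathbb{C}^4$ with scheme-theoretic support $Z$ are in bijective correspondence with the (finitely many) closed points of $$\bigcup_{m\ge0}\mathrm{Quot}_W(T_0(\mathcal{O}_W),m)^{(\mathbb{C}^*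 )^4},$$ where $\mathrm{Quot}_W(T_0(\mathcal{O}_W),m)$ is the Quot scheme of length $m$ zero-dimensional quotients of $T_0(\mathcal{O}_W)$.
   Context: The torus $(\mathbb{C}^* )^4$ acts on $\mathbb{C}^4=\operatorname{Spec}\mathbb{C}[x_1,x_2,x_3,x_4]$ by $x_i\mapsto t_ix_i$. For a coherent sheaf $E$, $T_i(E)\subset E$ is its maximal subsheaf of dimension $\le i$. A $\mathrm{PT}_0$ pair on $\mathbb{C}^4$ is a pair $(F,s)$ of a coherent sheaf $F$ with 2-dimensional support (properness of the support is not required here) having no nonzero $0$-dimensional subsheaf, together with a section $s\in H^0(F)$ whose cokernel is at most $0$-dimensional. Its scheme-theoretic support $Z$ is the scheme-theoretic support of $F$ (equivalently of $s$), so $\mathcal{O}_Z\subset F$ has no $0$-dimensional subsheaf. Pairs are taken up to isomorphism. A partition is a subset $\lambda\subset\mathbb{Z}_{\ge0}^2$ closed under decreasing coordinates; it is finite if it is a finite set (possibly empty). For $1\le a<b\le4$ with complementary indices $c<d$, and a finite partition $\lambda_{ab}$, $Z_{\lambda_{ab}}\subset\mathbb{C}^4$ is the $(\mathbb{C}^* )^4$-invariant closed subscheme such that the monomials $x_1^{i_1}x_2^{i_2}x_3^{i_3}x_4^{i_4}$ not in its ideal are exactly those with $(i_c,i_d)\in\lambda_{ab}$ ($i_a,i_b\ge0$ arbitrary); it is empty if $\lambda_{ab}=\varnothing$ and otherwise pure 2-dimensional. Every pure 2-dimensional $(\mathbb{C}^* )^4$-invariant closed subscheme of $\mathbb{C}^4$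 is uniquely of the form $\bigcup_{a<b}Z_{\lambda_{ab}}$. *)

(* Defs.v *)
From HB Require Import structures.
From mathcomp Require Import all_boot all_order all_algebra.
From mathcomp Require Import boolp reals prodnormedzmodule.
From mathcomp Require Import complex.
From mathcomp Require Import finmap mpoly.

Set Implicit Arguments.
Unset Strict Implicit.
Unset Printing Implicit Defensive.

Import GRing.Theory.
Local Open Scope ring_scope.
Local Open Scope quotient_scope.

(* Coherent sheaves on the affine space are represented by finitely generated
   modules over the coordinate ring, closed subschemes by ideals. *)

Section Modules.
Variable A : comNzRingType.
Implicit Types M N : lmodType A.

Record submodule M := Submodule {
  sub_pred :> {pred M};
  sub_closed : submod_closed sub_pred }.

HB.instance Definition _ M (S : submodule M) :=
  GRing.isSubmodClosed.Build A M (sub_pred S) (sub_closed S).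

Section SubAndQuotient.
Variables (M : lmodType A) (S : submodule M).

Record subm := Subm { subm_val : M; subm_valP : subm_val \in sub_pred S }.

HB.instance Definition _ := [isSub for subm_val].
HB.instance Definition _ := [Choice of subm by <:].
HB.instance Definition _ := [SubChoice_isSubLmodule of subm by <:].

Definition incl : {linear subm -> M} := val.

Definition quotm := Quotient.quot (sub_pred S).

HB.instance Definition _ := EqQuotient.on quotm.
HB.instance Definition _ := GRing.Zmodule.on quotm.

Lemma quotm_eq (x y : M) :
  (\pi_quotm x = \pi_quotm y) <-> (x - y \in sub_pred S).
Proof.
by rewrite (Quotient.idealrBE (sub_pred S)); split=> [->|/eqP].
Qed.

Lemma quotm_ind (P : quotm -> Prop) :
  (forall y : M, P (\pi_quotm y)) -> forall x, P x.
Proof. by move=> HP x; rewrite -[x]reprK. Qed.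

Lemma pi_quotmD : {morph \pi_quotm : x y / x + y}.
Proof. exact: (raddfD (\pi_quotm : {additive M -> Quotient.quot (sub_pred S)})). Qed.

Definition quotm_scale (a : A) (x : quotm) : quotm :=
  \pi_quotm (a *: repr x).

Lemma quotm_scaleE a (x : M) : quotm_scale a (\pi_quotm x) = \pi_quotm (a *: x).
Proof.
apply/quotm_eq; rewrite -scalerBr; apply: rpredZ.
by apply/quotm_eq; rewrite reprK.
Qed.

Fact quotm_scalerA a b x :
  quotm_scale a (quotm_scale b x) = quotm_scale (a * b) x.
Proof. by elim/quotm_ind: x => x; rewrite !quotm_scaleE scalerA. Qed.
Fact quotm_scale1r : left_id 1 quotm_scale.
Proof. by elim/quotm_ind => x; rewrite quotm_scaleE scale1r. Qed.
Fact quotm_scalerDr : right_distributive quotm_scale +%R.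
Proof.
move=> a; elim/quotm_ind => x; elim/quotm_ind => y.
by rewrite -pi_quotmD !quotm_scaleE scalerDr pi_quotmD.
Qed.
Fact quotm_scalerDl x : {morph quotm_scale^~ x : a b / a + b}.
Proof.
elim/quotm_ind: x => x a b.
by rewrite !quotm_scaleE scalerDl pi_quotmD.
Qed.

HB.instance Definition _ := GRing.Zmodule_isLmodule.Build A quotm
  quotm_scalerA quotm_scale1r quotm_scalerDr quotm_scalerDl.

Definition proj_fun (x : M) : quotm := \pi_quotm x.
Fact proj_is_linear : linear proj_fun.
Proof. by move=> a x y; rewrite /proj_fun pi_quotmD -quotm_scaleE. Qed.
HB.instance Definition _ :=
  GRing.isLinear.Build A M quotm *:%R proj_fun proj_is_linear.

Definition proj : {linear M -> quotm} := proj_fun.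

End SubAndQuotient.

Fact span_closed M (G : M -> Prop) :
  submod_closed [pred x | `[< forall N : submodule M,
    (forall y, G y -> y \in N) -> x \in N >]].
Proof.
split=> [|a x y]; rewrite !inE.
  by apply/asboolP => N _; exact: rpred0.
move=> /asboolP Hx /asboolP Hy; apply/asboolP => N GN.
by apply: rpredD; [apply: rpredZ; exact: Hx | exact: Hy].
Qed.

Definition span M (G : M -> Prop) : submodule M := Submodule (span_closed G).

Lemma mem_span M (G : M -> Prop) x : G x -> x \in span G.
Proof. by move=> Gx; rewrite inE; apply/asboolP => N; apply. Qed.

Lemma span_min M (G : M -> Prop) (N : submodule M) :
  (forall y, G y -> y \in N) -> forall x, x \in span G -> x \in N.
Proof. by move=> GN x; rewrite inE => /asboolP; apply. Qed.

Definition cyclic M (u : M) : submodule M := span (fun x => x = u).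

Definition sum_sub M (S T : submodule M) : submodule M :=
  span (fun x => x \in S \/ x \in T).

Definition fingen M : Prop :=
  exists n (e : 'I_n -> M), forall x, exists c : 'I_n -> A,
    x = \sum_i c i *: e i.

Definition annih M (S : {pred M}) : {pred A} :=
  [pred f | `[< forall x, x \in S -> f *: x = 0 >]].

Definition prime_ideal (p : {pred A}) : Prop :=
  idealr_closed p /\ prime_idealr_closed p.

(* Krull dimension of A / I at most d; in particular dim_le I d holds for all d
   when 1 is in I. *)
Definition dim_le (I : {pred A}) (d : nat) : Prop :=
  forall p : 'I_d.+2 -> {pred A},
    (forall i, prime_ideal (p i)) ->
    (forall i, {subset I <= p i}) ->
    ~ (forall i j : 'I_d.+2, (i < j)%N ->
         {subset p i <= p j} /\ ~ {subset p j <= p i}).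

(* The dimension of a sheaf is that of its support V(Ann). *)
Definition mod_dim_le M (d : nat) : Prop := dim_le (annih (predT : {pred M})) d.
Definition sub_dim_le M (S : submodule M) (d : nat) : Prop := dim_le (annih S) d.

Lemma annih_span M (G : M -> Prop) f :
  (forall x, G x -> f *: x = 0) -> f \in annih (span G).
Proof.
move=> fG; rewrite inE; apply/asboolP.
have kcl : submod_closed [pred x : M | f *: x == 0].
  split=> [|a x y]; rewrite !inE ?scaler0 // => /eqP fx /eqP fy.
  by rewrite scalerDr scalerA mulrC -scalerA fx fy scaler0 addr0.
have h := @span_min _ G (Submodule kcl).
move=> x /h; rewrite inE => /(_ _)/eqP; apply=> y /fG fy.
by rewrite inE fy.
Qed.

Lemma sum_sub_dim_le M (S T : submodule M) d :
  sub_dim_le S d -> sub_dim_le T d -> sub_dim_le (sum_sub S T) d.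
Proof.
move=> dS dT p pP pann pch.
have p0min i : {subset p ord0 <= p i}.
  case: (posnP i) => [i0|]; last by move=> /(pch ord0)[].
  by have -> : i = ord0 by apply/val_inj.
have [annS|/existsNP[f /not_implyP[fS fp]]] :=
  pselect ({subset annih S <= p ord0}).
  by apply: (dS p pP) => // i f /annS /p0min.
have [annT|/existsNP[g /not_implyP[gT gp]]] :=
  pselect ({subset annih T <= p ord0}).
  by apply: (dT p pP) => // i g /annT /p0min.
have : f * g \in annih (sum_sub S T).
  move: fS gT; rewrite !inE => /asboolP fS /asboolP gT.
  apply: annih_span => x [/fS fx|/gT gx].
    by rewrite mulrC -scalerA fx scaler0.
  by rewrite -scalerA gx scaler0.
by move=> /(pann ord0)/(proj2 (pP ord0)) /orP[].
Qed.

Fact torsion_closed M d : submod_closed [pred x : M |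
  `[< exists2 N : submodule M, sub_dim_le N d & x \in N >]].
Proof.
split=> [|a x y]; rewrite !inE.
  apply/asboolP; exists (cyclic 0); last exact: rpred0.
  move=> p pP pann _.
  have : 1 \in p ord0.
    apply: pann; apply: annih_span => _ ->; exact: scaler0.
  by case: (pP ord0) => -[_ /negP].
move=> /asboolP[N dN Nx] /asboolP[N' dN' N'y]; apply/asboolP.
exists (sum_sub N N'); first exact: sum_sub_dim_le.
by apply: rpredD; [apply: rpredZ|]; apply: mem_span; [left|right].
Qed.

(* T_d(M): the largest submodule of dimension at most d, i.e. the union of all
   of them. *)
Definition T_ (d : nat) M : submodule M := Submodule (@torsion_closed M d).

Section HomModule.
Variables U V : lmodType A.
Implicit Types f g h : {linear U -> V}.

Definition hom_zero : {linear U -> V} := \0.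
Definition hom_opp f : {linear U -> V} := \- f.
Definition hom_add f g : {linear U -> V} := f \+ g.
Definition hom_scale (a : A) f : {linear U -> V} := a \*: f.

Lemma hom_ext f g : f =1 g -> f = g.
Proof.
case: f g => f [[af] [sf]] [g [[ag] [sg]]] /= /funext fg.
move: af sf; rewrite fg => af sf.
by rewrite (Prop_irrelevance af ag) (Prop_irrelevance sf sg).
Qed.

Fact hom_addA : associative hom_add.
Proof. by move=> f g h; apply: hom_ext => x /=; rewrite addrA. Qed.
Fact hom_addC : commutative hom_add.
Proof. by move=> f g; apply: hom_ext => x /=; rewrite addrC. Qed.
Fact hom_add0 : left_id hom_zero hom_add.
Proof. by move=> f; apply: hom_ext => x /=; rewrite add0r. Qed.
Fact hom_addN : left_inverse hom_zero hom_opp hom_add.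
Proof. by move=> f; apply: hom_ext => x /=; rewrite addNr. Qed.
HB.instance Definition _ := GRing.isZmodule.Build {linear U -> V}
  hom_addA hom_addC hom_add0 hom_addN.

Fact hom_scalerA a b f : hom_scale a (hom_scale b f) = hom_scale (a * b) f.
Proof. by apply: hom_ext => x /=; rewrite scalerA. Qed.
Fact hom_scale1r : left_id 1 hom_scale.
Proof. by move=> f; apply: hom_ext => x /=; rewrite scale1r. Qed.
Fact hom_scalerDr : right_distributive hom_scale +%R.
Proof. by move=> a f g; apply: hom_ext => x /=; rewrite scalerDr. Qed.
Fact hom_scalerDl f : {morph hom_scale^~ f : a b / a + b}.
Proof. by move=> a b; apply: hom_ext => x /=; rewrite scalerDl. Qed.
HB.instance Definition _ := GRing.Zmodule_isLmodule.Build A {linear U -> V}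
  hom_scalerA hom_scale1r hom_scalerDr hom_scalerDl.

Lemma hom_addE f g x : (f + g) x = f x + g x. Proof. by []. Qed.
Lemma hom_scaleE a f x : (a *: f) x = a *: f x. Proof. by []. Qed.

End HomModule.

Definition short_exact L M N (f : {linear L -> M}) (g : {linear M -> N}) : Prop :=
  [/\ injective f, forall y, g y = 0 <-> exists x, y = f x
    & forall z, exists y, z = g y].

Record dirsys := Dirsys {
  ds_mod :> nat -> lmodType A;
  ds_tr : forall r s, (r <= s)%N -> {linear ds_mod r -> ds_mod s};
  ds_id : forall r (h : (r <= r)%N) x, ds_tr h x = x;
  ds_comp : forall r s t (h : (r <= s)%N) (k : (s <= t)%N) (l : (r <= t)%N) x,
    ds_tr k (ds_tr h x) = ds_tr l x }.
Arguments ds_tr {d r s} h.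

Section DirectLimit.
Variable D : dirsys.

Definition germ := {r : nat & D r}.
HB.instance Definition _ := Choice.on germ.

Definition germ_eq (x y : germ) : bool :=
  `[< exists t (h : (tag x <= t)%N) (k : (tag y <= t)%N),
        ds_tr h (tagged x) = ds_tr k (tagged y) >].

Fact germ_eq_equiv : equiv_class_of germ_eq.
Proof.
have sym x y : germ_eq x y -> germ_eq y x.
  by move=> /asboolP[t [h [k e]]]; apply/asboolP; exists t, k, h.
split=> [x|x y|y x z].
- by apply/asboolP; exists (tag x), (leqnn _), (leqnn _).
- by apply/idP/idP; exact: sym.
move=> /asboolP[t [h [k e]]] /asboolP[t' [h' [k' e']]]; apply/asboolP.
exists (maxn t t'), (leq_trans h (leq_maxl t t')), (leq_trans k' (leq_maxr t t')).
rewrite -(ds_comp h (leq_maxl t t')) e -(ds_comp k' (leq_maxr t t')) -e'.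
by rewrite !(ds_comp _ _ (leq_trans k (leq_maxl t t'))).
Qed.

Canonical germ_equiv := EquivRelPack germ_eq_equiv.
Canonical germ_encModRel := defaultEncModRel germ_eq.

Definition dirlim := {eq_quot germ_eq}.
HB.instance Definition _ : EqQuotient germ germ_eq dirlim :=
  EqQuotient.on dirlim.
HB.instance Definition _ := Choice.on dirlim.

Definition dl_in r (x : D r) : dirlim := \pi_dirlim (existT (fun n => D n : Type) r x).

Lemma dl_in_eq r s (x : D r) (y : D s) :
  dl_in x = dl_in y <->
  exists t (h : (r <= t)%N) (k : (s <= t)%N), ds_tr h x = ds_tr k y.
Proof.
split=> [/eqmodP/asboolP|h]; first exact.
by apply/eqmodP/asboolP.
Qed.

Lemma dl_in_tr r s (h : (r <= s)%N) (x : D r) : dl_in (ds_tr h x) = dl_in x.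
Proof.
by apply/dl_in_eq; exists s, (leqnn s), h; rewrite ds_id.
Qed.

Lemma dl_ind (P : dirlim -> Prop) :
  (forall r (x : D r), P (dl_in x)) -> forall x, P x.
Proof.
by move=> HP x; rewrite -[x]reprK; case: (repr x) => r y; exact: HP.
Qed.

Lemma dl_ind2 (P : dirlim -> dirlim -> Prop) :
  (forall r (x y : D r), P (dl_in x) (dl_in y)) -> forall x y, P x y.
Proof.
move=> HP; elim/dl_ind => r x; elim/dl_ind => s y.
by rewrite -(dl_in_tr (leq_maxl r s) x) -(dl_in_tr (leq_maxr r s) y).
Qed.

Lemma dl_ind3 (P : dirlim -> dirlim -> dirlim -> Prop) :
  (forall r (x y z : D r), P (dl_in x) (dl_in y) (dl_in z)) ->
  forall x y z, P x y z.
Proof.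
move=> HP; apply: dl_ind2 => r x y; apply: dl_ind => s z.
rewrite -(dl_in_tr (leq_maxl r s) x) -(dl_in_tr (leq_maxl r s) y).
by rewrite -(dl_in_tr (leq_maxr r s) z).
Qed.

Definition dl_zero : dirlim := @dl_in 0 0.
Definition dl_opp (x : dirlim) : dirlim := dl_in (- tagged (repr x)).
Definition dl_add (x y : dirlim) : dirlim :=
  dl_in (ds_tr (leq_maxl (tag (repr x)) (tag (repr y))) (tagged (repr x)) +
         ds_tr (leq_maxr (tag (repr x)) (tag (repr y))) (tagged (repr y))).
Definition dl_scale (a : A) (x : dirlim) : dirlim := dl_in (a *: tagged (repr x)).

Lemma dl_reprP (x : dirlim) : dl_in (tagged (repr x)) = x.
Proof. by rewrite -[RHS]reprK; case: (repr x). Qed.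

Lemma dl_in_eqP r (x y : D r) : dl_in x = dl_in y ->
  exists t (h : (r <= t)%N), ds_tr h x = ds_tr h y.
Proof.
by move=> /dl_in_eq[t [h [k e]]]; exists t, h; rewrite e (bool_irrelevance h k).
Qed.

Lemma dl_zeroE r : dl_in (0 : D r) = dl_zero.
Proof.
by apply/dl_in_eq; exists r, (leqnn r), (leq0n r); rewrite !linear0.
Qed.

Lemma dl_oppE r (x : D r) : dl_opp (dl_in x) = dl_in (- x).
Proof.
have /dl_in_eq[t [h [k e]]] := dl_reprP (dl_in x).
by apply/dl_in_eq; exists t, h, k; rewrite !linearN e.
Qed.

Lemma dl_scaleE a r (x : D r) : dl_scale a (dl_in x) = dl_in (a *: x).
Proof.
have /dl_in_eq[t [h [k e]]] := dl_reprP (dl_in x).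
by apply/dl_in_eq; exists t, h, k; rewrite !linearZ e.
Qed.

Lemma dl_addE r (x y : D r) : dl_add (dl_in x) (dl_in y) = dl_in (x + y).
Proof.
rewrite /dl_add; set u := repr (dl_in x); set v := repr (dl_in y).
have /dl_in_eq[t [h [k e]]] : dl_in (tagged u) = dl_in x by exact: dl_reprP.
have /dl_in_eq[t' [h' [k' e']]] : dl_in (tagged v) = dl_in y by exact: dl_reprP.
set m := maxn _ _; pose w := maxn m (maxn t t').
have tw : (t <= w)%N by rewrite /w !leq_max leqnn !orbT.
have tw' : (t' <= w)%N by rewrite /w !leq_max leqnn !orbT.
have mw : (m <= w)%N by rewrite leq_maxl.
apply/dl_in_eq; exists w, mw, (leq_trans k tw).
rewrite !linearD; congr (_ + _).
  by rewrite (ds_comp _ _ (leq_trans h tw)) -(ds_comp h tw) e; exact: ds_comp.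
by rewrite (ds_comp _ _ (leq_trans h' tw')) -(ds_comp h' tw') e'; exact: ds_comp.
Qed.

Fact dl_addA : associative dl_add.
Proof. by apply: dl_ind3 => r x y z; rewrite !dl_addE addrA. Qed.
Fact dl_addC : commutative dl_add.
Proof. by apply: dl_ind2 => r x y; rewrite !dl_addE addrC. Qed.
Fact dl_add0 : left_id dl_zero dl_add.
Proof. by elim/dl_ind => r x; rewrite -(dl_zeroE r) dl_addE add0r. Qed.
Fact dl_addN : left_inverse dl_zero dl_opp dl_add.
Proof. by elim/dl_ind => r x; rewrite dl_oppE dl_addE addNr dl_zeroE. Qed.
HB.instance Definition _ :=
  GRing.isZmodule.Build dirlim dl_addA dl_addC dl_add0 dl_addN.

Fact dl_scalerA a b x : dl_scale a (dl_scale b x) = dl_scale (a * b) x.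
Proof. by elim/dl_ind: x => r x; rewrite !dl_scaleE scalerA. Qed.
Fact dl_scale1r : left_id 1 dl_scale.
Proof. by elim/dl_ind => r x; rewrite dl_scaleE scale1r. Qed.
Fact dl_scalerDr : right_distributive dl_scale +%R.
Proof.
move=> a; apply: dl_ind2 => r x y.
by rewrite -[_ + _]/(dl_add _ _) -[X in _ = X]/(dl_add _ _)
           !(dl_addE, dl_scaleE) scalerDr.
Qed.
Fact dl_scalerDl x : {morph dl_scale^~ x : a b / a + b}.
Proof.
elim/dl_ind: x => r x a b.
by rewrite -[X in _ = X]/(dl_add _ _) !(dl_addE, dl_scaleE) scalerDl.
Qed.
HB.instance Definition _ := GRing.Zmodule_isLmodule.Build A dirlim
  dl_scalerA dl_scale1r dl_scalerDr dl_scalerDl.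

Fact dl_in_is_linear r : linear (@dl_in r).
Proof.
move=> a x y; rewrite -[X in _ = X]/(dl_add (dl_scale _ _) _).
by rewrite dl_scaleE dl_addE.
Qed.
HB.instance Definition _ r :=
  GRing.isLinear.Build A (D r) dirlim *:%R (@dl_in r) (@dl_in_is_linear r).

End DirectLimit.

(* lim_r Hom(S_r, M) for a decreasing sequence of submodules S_r of U, with
   restriction as transition maps. *)

Record filtration (U : lmodType A) := Filtration {
  fil :> nat -> submodule U;
  fil_dec : forall r s, (r <= s)%N -> {subset fil s <= fil r} }.

Section LimHom.
Variables (U : lmodType A) (S : filtration U).

Section Restriction.
Variables (r s : nat) (h : (r <= s)%N).

Definition fil_incl (x : subm (S s)) : subm (S r) :=
  Subm (fil_dec h (subm_valP x)).
Fact fil_incl_is_linear : linear fil_incl.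
Proof. by move=> a x y; apply: val_inj. Qed.
HB.instance Definition _ := GRing.isLinear.Build A (subm (S s)) (subm (S r))
  *:%R fil_incl fil_incl_is_linear.

Definition restr M (phi : {linear subm (S r) -> M}) :
  {linear subm (S s) -> M} := phi \o fil_incl.
Fact restr_is_linear M : linear (@restr M).
Proof. by move=> a x y; apply: hom_ext. Qed.
HB.instance Definition _ M := GRing.isLinear.Build A
  {linear subm (S r) -> M} {linear subm (S s) -> M} *:%R (@restr M)
  (@restr_is_linear M).
End Restriction.

Fact restr_id M r (h : (r <= r)%N) (phi : {linear subm (S r) -> M}) :
  restr h phi = phi.
Proof. by apply: hom_ext => x /=; congr (phi _); apply: val_inj. Qed.
Fact restr_comp M r s t (h : (r <= s)%N) (k : (s <= t)%N) (l : (r <= t)%N)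
  (phi : {linear subm (S r) -> M}) : restr k (restr h phi) = restr l phi.
Proof. by apply: hom_ext => x /=; congr (phi _); apply: val_inj. Qed.

Definition hom_sys M : dirsys :=
  @Dirsys (fun r => {linear subm (S r) -> M} : lmodType A)
    (fun r s h => @restr r s h M) (@restr_id M) (@restr_comp M).

Definition limhom M := dirlim (hom_sys M).
HB.instance Definition _ M := GRing.Lmodule.on (limhom M).

Definition limhom_in M r (phi : {linear subm (S r) -> M}) : limhom M :=
  @dl_in (hom_sys M) r phi.

Section Functoriality.
Variables (M N : lmodType A) (g : {linear M -> N}).

Definition limhom_map_fun (x : limhom M) : limhom N :=
  limhom_in (g \o tagged (repr (x : dirlim _)) : {linear _ -> _}).

Lemma limhom_mapE r (phi : {linear subm (S r) -> M}) :
  limhom_map_fun (limhom_in phi) = limhom_in (g \o phi : {linear _ -> _}).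
Proof.
have /dl_in_eq[t [h [k e]]] := @dl_reprP (hom_sys M) (limhom_in phi).
apply/dl_in_eq; exists t, h, k; apply: hom_ext => x /=; congr (g _).
exact: (congr1 (fun f : {linear subm (S t) -> M} => f x) e).
Qed.

Fact limhom_map_is_linear : linear limhom_map_fun.
Proof.
move=> a; apply: (@dl_ind2 (hom_sys M)) => r phi psi.
rewrite -[a *: _ + _](linearP (@dl_in (hom_sys M) r)).
rewrite -!/(limhom_in _) !limhom_mapE /limhom_in.
rewrite -[RHS](linearP (@dl_in (hom_sys N) r)); congr dl_in.
by apply: hom_ext => x /=; rewrite linearP.
Qed.
HB.instance Definition _ := GRing.isLinear.Build A (limhom M) (limhom N)
  *:%R limhom_map_fun limhom_map_is_linear.
Definition limhom_map : {linear limhom M -> limhom N} := limhom_map_fun.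
End Functoriality.
End LimHom.
End Modules.

(* For f semilinear, these are the induced map of M / S (if f preserves S), the
   restriction of f to S (if f preserves S), and the map phi |-> g o phi o f on
   homomorphisms (if that composite is linear); outside of the parenthesized
   conditions the values are irrelevant defaults. *)
Section InducedMaps.
Variable A : comNzRingType.

Definition quot_map (M : lmodType A) (S : submodule M) (f : M -> M)
  (x : quotm S) : quotm S := proj S (f (repr x)).

Definition sub_map (M : lmodType A) (S : submodule M) (f : M -> M)
  (x : subm S) : subm S := insubd x (f (val x)).

Definition hom_map (U V : lmodType A) (f : U -> U) (g : V -> V)
  (phi : {linear U -> V}) : {linear U -> V} :=
  if pselect (exists psi : {linear U -> V}, forall x, psi x = g (phi (f x)))
    is left h then projT1 (cid h) else phi.

Definition limhom_act (U M : lmodType A) (S : filtration U) (f : U -> U)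
  (g : M -> M) (x : limhom S M) : limhom S M :=
  limhom_in (hom_map (sub_map f) g (tagged (repr (x : dirlim _)))).

Lemma quot_mapE (M : lmodType A) (S : submodule M) (f : M -> M) x :
  (forall y, y \in S -> f y \in S) -> {morph f : y z / y - z} ->
  quot_map f (proj S x) = proj S (f x).
Proof.
move=> fS fB; apply/quotm_eq; rewrite -fB; apply: fS.
by apply/quotm_eq; rewrite reprK.
Qed.

Lemma sub_mapE (M : lmodType A) (S : submodule M) (f : M -> M) (x : subm S) :
  (forall y, y \in S -> f y \in S) -> val (sub_map f x) = f (val x).
Proof. by move=> fS; rewrite val_insubd fS //; exact: valP. Qed.

Lemma hom_mapE (U V : lmodType A) (f : U -> U) (g : V -> V)
  (phi psi : {linear U -> V}) :
  (forall x, psi x = g (phi (f x))) -> hom_map f g phi = psi.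
Proof.
move=> e; rewrite /hom_map; case: pselect => [h|[]]; last by exists psi.
by apply: hom_ext => x; rewrite (projT2 (cid h)) e.
Qed.

End InducedMaps.

Section Ideals.
Variable A : comNzRingType.

Definition ideal := submodule (A^o).

Fact annih_closed (M : lmodType A) :
  submod_closed (annih (predT : {pred M}) : {pred A^o}).
Proof.
split=> [|a f g]; rewrite !inE.
  by apply/asboolP => x _; rewrite scale0r.
move=> /asboolP fM /asboolP gM; apply/asboolP => x xM.
by rewrite scalerDl -scalerA fM ?gM // scaler0 addr0.
Qed.

(* The ideal of the scheme-theoretic support. *)
Definition supp_ideal (M : lmodType A) : ideal := Submodule (@annih_closed M).

(* The ideal of the subscheme Z_1 of Z = V(I) with O_Z1 = O_Z / T_1(O_Z). *)
Definition pure_part (I : ideal) : {pred A} :=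
  [pred f : A | proj I f \in T_ 1 (quotm I)].

Variables (I : ideal) (J : {pred A}).

Definition quot_pow (r : nat) : submodule (quotm I) :=
  span (fun x => exists g : 'I_r -> A,
    (forall i, g i \in J) /\ x = proj I (\prod_i g i)).

Fact quot_pow_dec r s : (r <= s)%N -> {subset quot_pow s <= quot_pow r}.
Proof.
move=> /subnKC <-; apply: span_min => _ [g [gm ->]].
have projZ (a f : A) : proj I (f * a) = a *: proj I f.
  by rewrite mulrC; exact: (linearZ_LR (proj I) a (f : A^o)).
rewrite big_split_ord projZ; apply: rpredZ; apply: mem_span.
by exists (fun i => g (lshift _ i)).
Qed.

(* The powers of the ideal J O_Z of O_Z = A / I; the zeroth one is O_Z. *)
Definition quot_pow_fil : filtration (quotm I) := Filtration quot_pow_dec.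

End Ideals.

Section AffineSpace.
Variable R : realType.
Local Notation C := R[i].
Local Notation A := {mpoly C[4]}.

Definition origin : {pred A} := [pred f : A | f.@[fun _ => 0] == 0].

(* A diagram is a finite partition, as a set of boxes. The coordinates
   x_1, ..., x_4 are 'X_0, ..., 'X_3; a family of diagrams lam is only used at
   lam a b with a < b. *)

Record diagram := Diagram {
  part_set :> {fset nat * nat};
  part_closed : forall i j i' j', (i' <= i)%N -> (j' <= j)%N ->
    (i, j) \in part_set -> (i', j') \in part_set }.

Fact plane_closed (l : diagram) (a b : 'I_4) :
  submod_closed ([pred f : A^o | `[< forall c d : 'I_4, (c < d)%N ->
    uniq [:: a; b; c; d] ->
    forall m : 'X_{1..4}, (m c, m d) \in part_set l -> (f : A)@_m = 0 >]]).
Proof.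
split=> [|p f g]; rewrite !inE.
  by apply/asboolP => *; rewrite mcoeff0.
move=> /asboolP fl /asboolP gl; apply/asboolP => c d cd u m ml.
rewrite mcoeffD (gl c d) // addr0 mcoeffM big1 // => -[k k'] /= /eqP mk.
rewrite [X in _ * X](fl c d) ?mulr0 //.
have k'm i : (k' i <= m i)%N.
  by rewrite (congr1 (fun x : 'X_{1..4} => x i) mk) mnmDE leq_addl.
by apply: part_closed ml; exact: k'm.
Qed.

(* The ideal of Z_(l), l = lambda_ab: it is spanned by the monomials x^m with
   (m_c, m_d) not in l, where c < d are the indices other than a and b. *)
Definition plane_ideal (l : diagram) (a b : 'I_4) : ideal A :=
  Submodule (@plane_closed l a b).

Section Planes.
Variables (lam : 'I_4 -> 'I_4 -> diagram) (Q : rel 'I_4).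

Fact planes_closed : submod_closed ([pred f : A^o | `[< forall a b : 'I_4,
  (a < b)%N -> Q a b -> f \in plane_ideal (lam a b) a b >]]).
Proof.
split=> [|p f g]; rewrite !inE; first by apply/asboolP => *; exact: rpred0.
move=> /asboolP fl /asboolP gl; apply/asboolP => a b ab Qab.
by apply: rpredD; [apply: rpredZ; exact: fl | exact: gl].
Qed.

(* The ideal of the union of the Z_(lambda_ab) over a < b with Q a b. *)
Definition planes_ideal : ideal A := Submodule planes_closed.
End Planes.

(* The ideal of W; ord_max : 'I_4 is the index of the fourth coordinate. *)
Definition W_ideal (lam : 'I_4 -> 'I_4 -> diagram) : ideal A :=
  sum_sub (planes_ideal lam (fun _ b => b != ord_max))
          (planes_ideal lam (fun _ b => b == ord_max)).

Definition torus (t : 'I_4 -> C) : Prop := forall i, t i != 0.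

Definition twist (t : 'I_4 -> C) : A -> A :=
  comp_mpoly [tuple t i *: 'X_i | i < 4].
HB.instance Definition _ t := GRing.RMorphism.on (twist t).

Definition act_quot (I : ideal A) t : quotm I -> quotm I :=
  quot_map (twist t : A^o -> A^o).

Definition O_Z1 (I : ideal A) : lmodType A := quotm (T_ 1 (quotm I)).

Definition act_Z1 (I : ideal A) t : O_Z1 I -> O_Z1 I :=
  quot_map (@act_quot I t).

Definition T0W (lam : 'I_4 -> 'I_4 -> diagram) : lmodType A :=
  subm (T_ 0 (quotm (W_ideal lam))).

Definition act_T0W lam t : T0W lam -> T0W lam :=
  sub_map (@act_quot (W_ideal lam) t).

Definition limHom (I : ideal A) (M : lmodType A) : lmodType A :=
  limhom (quot_pow_fil I origin) M.

(* (t . phi)(x) = t . phi (t^-1 . x) *)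
Definition act_limHom_Z1 (I : ideal A) t :
    limHom I (O_Z1 I) -> limHom I (O_Z1 I) :=
  limhom_act (@act_quot I (fun i => (t i)^-1)) (@act_Z1 I t).

(* The class of the restriction to m^0 = O_Z of the projection O_Z -> O_Z1, that
   is, the image of 1 under O_Z1 -> lim_r Hom(m^r, O_Z1). *)
Definition lim_one (I : ideal A) : limHom I (O_Z1 I) :=
  @limhom_in _ _ (quot_pow_fil I origin) (O_Z1 I) 0
    (proj (T_ 1 (quotm I)) \o incl _ : {linear _ -> _}).

(* lim_r Hom(m^r, O_Z1) / O_Z1 *)
Definition limHom_mod (I : ideal A) : lmodType A :=
  quotm (cyclic (lim_one I)).

Definition act_limHom_mod (I : ideal A) t : limHom_mod I -> limHom_mod I :=
  quot_map (@act_limHom_Z1 I t).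

Record pair := Pair { pair_mod : lmodType A; pair_sec : pair_mod }.

Record PT0_pair (P : pair) : Prop := {
  PT0_coherent : fingen (pair_mod P);
  PT0_dim2 : mod_dim_le (pair_mod P) 2 /\ ~ mod_dim_le (pair_mod P) 1;
  PT0_pure : forall N : submodule (pair_mod P), sub_dim_le N 0 ->
    forall x, x \in N -> x = 0;
  PT0_coker : mod_dim_le (quotm (cyclic (pair_sec P))) 0 }.

Definition pair_iso (P P' : pair) : Prop :=
  exists f : {linear pair_mod P -> pair_mod P'},
    bijective f /\ f (pair_sec P) = pair_sec P'.

(* An isomorphism of (F, s) with its pullback under t is a bijection of F that
   fixes s and is semilinear over the automorphism twist t of A. *)
Definition T_fixed (P : pair) : Prop := forall t, torus t ->
  exists f : {linear pair_mod P -> pair_mod P | twist t \; *:%R},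
    bijective f /\ f (pair_sec P) = pair_sec P.

Definition pair_supp (P : pair) : ideal A := supp_ideal (pair_mod P).

(* Quot schemes: a closed point is given by the kernel of a quotient, and length
   is dimension over C. *)

Definition has_length (M : lmodType A) (m : nat) : Prop :=
  exists e : 'I_m -> M, forall x,
    exists! c : {ffun 'I_m -> C}, x = \sum_i (c i)%:MP *: e i.

Definition fixed_quot_point lam (m : nat) (K : submodule (T0W lam)) : Prop :=
  has_length (quotm K) m /\
  forall t, torus t -> forall x, x \in K -> act_T0W t x \in K.

End AffineSpace.

(* Main.v *)
(* The support ideal I of a fixed pair is torus-invariant, hence monomial, and the
   powers of the four variables detect everything supported at the origin: lim_r
   Hom(m^r, M) is computed by Cech cochains (b_i) with x_j^r b_i = x_i^r b_j.

   T_1(O_Z) is killed by (x_i x_j)^N for i <> j, so a cochain of O_Z1 becomes a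
   cocycle of O_Z after multiplying lifts of its entries by x_i^N: this gives the
   exactness. Next, Z_1 is the union of Z' (the planes 12, 13, 23) and Z'' (the
   planes 14, 24, 34). Within each half any two planes share a coordinate axis, so
   by Mayer-Vietoris neither O_Z' nor O_Z'' has local cohomology in degrees 0 and 1
   at the origin. A germ phi is therefore multiplication by some f' on Z' and by
   some f'' on Z'', and phi |-> f' - f'' identifies lim_r Hom(m^r, O_Z1) / O_Z1 with
   the torsion at the origin of O_W, W being the intersection of Z' and Z''.

   In a fixed pair (F, s) the cokernel of s is killed by a power of m, so F embeds
   in O_Z' x O_Z'' and is determined by the submodule K of all f' - f''; conversely
   K gives F = {(a, b) | a - b in K} with s = (1, 1). Finally, a monomial that is
   nonzero in T_0(O_W) has bounded exponents, and a torus-invariant submodule is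
   spanned by monomials, so there are finitely many K. *)
Require Import Defs.
From HB Require Import structures.
From mathcomp Require Import all_boot all_order all_algebra.
From mathcomp Require Import boolp reals complex finmap mpoly.

Set Implicit Arguments.
Unset Strict Implicit.
Unset Printing Implicit Defensive.

Import GRing.Theory Num.Theory.
Local Open Scope ring_scope.

(** * Linear relations and quotient modules *)

Section LinearRelations.
Variable A : comNzRingType.
Implicit Types M N : lmodType A.

Definition linear_fun M N (f : M -> N) (lin_f : linear f) : {linear M -> N} :=
  HB.pack f (GRing.isLinear.Build A M N *:%R f lin_f).

(** Maps out of limits and quotients are known only through chosen representatives, so they are
    built as functional relations of this kind. Taking a = -1 reduces uniqueness of values to the
    values at 0. *)
Definition linear_rel M N (P : M -> N -> Prop) : Prop :=
  forall a x x' y y', P x y -> P x' y' -> P (a *: x + x') (a *: y + y').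

Lemma linear_rel_inj M N (P : M -> N -> Prop) x y y' :
  linear_rel P -> (forall z, P 0 z -> z = 0) -> P x y -> P x y' -> y = y'.
Proof.
move=> linP P0 Pxy Pxy'; have := linP (-1) _ _ _ _ Pxy Pxy'.
by rewrite !scaleN1r addNr => /P0; rewrite addrC => /eqP; rewrite subr_eq0 => /eqP.
Qed.

Lemma linear_of_rel M N (P : M -> N -> Prop) :
  linear_rel P -> (forall x, exists y, P x y) -> (forall z, P 0 z -> z = 0) ->
  exists f : {linear M -> N}, forall x, P x (f x).
Proof.
move=> linP /choice[f Pf] P0.
have lin_f : linear f.
  move=> a x y; exact: (linear_rel_inj linP P0 (Pf _) (linP _ _ _ _ _ (Pf _) (Pf _))).
by exists (linear_fun lin_f).
Qed.

Lemma linear_bij_of_rel M N (P : M -> N -> Prop) :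
  linear_rel P -> (forall x, exists y, P x y) -> (forall z, P 0 z -> z = 0) ->
  (forall y, exists x, P x y) -> (forall z, P z 0 -> z = 0) ->
  exists f : {linear M -> N}, bijective f /\ forall x, P x (f x).
Proof.
move=> linP tot P0 sur P0'; have [f Pf] := linear_of_rel linP tot P0.
pose P' y x := P x y.
have linP' : linear_rel P' by move=> a x x' y y'; apply: linP.
have [g Pg] := linear_of_rel linP' sur P0'.
exists f; split=> //; exists g => x.
  exact: (linear_rel_inj linP' P0' (Pg _) (Pf _)).
exact: (linear_rel_inj linP P0 (Pf _) (Pg _)).
Qed.

(** Besides defining submodules, this allows induction over a span: a closed property becomes a
    submodule to which [span_min] applies. *)
Definition mk_submodule M (P : M -> Prop) (P0 : P 0)
    (PD : forall a x y, P x -> P y -> P (a *: x + y)) : submodule M.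
Proof.
exists [pred x | `[< P x >]]; split=> [|a x y]; rewrite !inE; first exact/asboolP.
by move=> /asboolP Px /asboolP Py; apply/asboolP; apply: PD.
Defined.

Lemma mk_submoduleP M (P : M -> Prop) P0 PD x :
  (x \in @mk_submodule M P P0 PD) <-> P x.
Proof. by rewrite inE; split=> /asboolP. Qed.

Lemma mem_sum_sub M (S T : submodule M) x :
  (x \in sum_sub S T) <-> exists y z, [/\ x = y + z, y \in S & z \in T].
Proof.
split; last first.
  by move=> [y [z [-> Sy Tz]]]; apply: rpredD; apply: mem_span; [left|right].
have P0 : exists y z, [/\ 0 = y + z, y \in S & z \in T].
  by exists 0, 0; rewrite addr0 !rpred0.
have PD a (u v : M) : (exists y z, [/\ u = y + z, y \in S & z \in T]) ->
    (exists y z, [/\ v = y + z, y \in S & z \in T]) ->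
    exists y z, [/\ a *: u + v = y + z, y \in S & z \in T].
  move=> [y [z [-> Sy Tz]]] [y' [z' [-> Sy' Tz']]].
  exists (a *: y + y'), (a *: z + z').
  split; first by rewrite scalerDr addrACA.
    by apply: rpredD; [apply: rpredZ|].
  by apply: rpredD; [apply: rpredZ|].
have h : forall y, y \in S \/ y \in T -> y \in mk_submodule P0 PD.
  move=> y [Sy|Ty]; apply/mk_submoduleP.
    by exists y, 0; rewrite addr0 rpred0.
  by exists 0, y; rewrite add0r rpred0.
by move=> /(span_min h)/mk_submoduleP.
Qed.

Lemma mem_sum_ideal (J J' : ideal A) (f : A) :
  (f \in sum_sub J J') <-> exists g h : A, [/\ f = g + h, g \in J & h \in J'].
Proof. exact: mem_sum_sub. Qed.

Lemma mem_cyclic M (u x : M) : (x \in cyclic u) <-> exists a, x = a *: u.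
Proof.
split; last by move=> [a ->]; apply: rpredZ; apply: mem_span.
have P0 : exists a, 0 = a *: u by exists 0; rewrite scale0r.
have PD a (y z : M) : (exists b, y = b *: u) -> (exists b, z = b *: u) ->
    exists b, a *: y + z = b *: u.
  by move=> [b ->] [c ->]; exists (a * b + c); rewrite scalerDl scalerA.
have h : forall y, y = u -> y \in mk_submodule P0 PD.
  by move=> _ ->; apply/mk_submoduleP; exists 1; rewrite scale1r.
by move=> /(span_min h)/mk_submoduleP.
Qed.

Lemma scaler_swap M a b (x : M) : a *: (b *: x) = b *: (a *: x).
Proof. by rewrite !scalerA mulrC. Qed.

(** Clearing denominators: if p q kills the defect of the cocycle relation between x and y, then p x
    and q y satisfy such a relation with larger coefficients. *)
Lemma scaled_cocycle M p q u v (x y : M) : p * q *: (v *: x - u *: y) = 0 ->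
  v * q *: (p *: x) = u * p *: (q *: y).
Proof.
move=> /eqP; rewrite scalerBr subr_eq0 !scalerA => /eqP e.
by rewrite -[v * q * p]mulrA mulrC [q * p]mulrC e -[u * p * q]mulrA [u * _]mulrC.
Qed.

Lemma proj_eq0 M (S : submodule M) x : (proj S x = 0) <-> (x \in S).
Proof. by rewrite -[in _ <-> _](linear0 (proj S)) quotm_eq subr0. Qed.

Lemma proj_eq M (S : submodule M) x y : (proj S x = proj S y) <-> (x - y \in S).
Proof. exact: quotm_eq. Qed.

Lemma projZ (J : ideal A) (a f : A) : proj J (a * f : A^o) = a *: proj J f.
Proof. exact: (linearZ_LR (proj J) a (f : A^o)). Qed.

Lemma idealM (J : ideal A) (a f : A) : f \in J -> a * f \in J.
Proof. exact: (rpredZ a). Qed.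

Lemma quotm_first_iso M N (S : submodule M) (f : {linear M -> N}) :
  (forall x, f x = 0 <-> x \in S) -> (forall y, exists x, f x = y) ->
  exists g : {linear quotm S -> N}, bijective g /\ forall x, g (proj S x) = f x.
Proof.
move=> kerf sur; pose P z y := exists2 x, z = proj S x & y = f x.
have linP : linear_rel P.
  by move=> a _ _ _ _ [x -> ->] [x' -> ->]; exists (a *: x + x'); rewrite linearP.
have P0 y : P 0 y -> y = 0.
  by move=> [x /esym/proj_eq0/kerf fx ->].
have [z|y|z||g [bij_g Pg]] := @linear_bij_of_rel _ _ P linP.
- by elim/quotm_ind: z => x; exists (f x), x.
- exact: P0.
- by have [x <-] := sur z; exists (proj S x), x.
- by move=> z [x -> /esym/kerf/proj_eq0].
by exists g; split=> // x; apply: linear_rel_inj linP P0 (Pg _) _; exists x.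
Qed.

Lemma ideal0 (J : ideal A) : (0 : A) \in J. Proof. exact: rpred0. Qed.

Lemma idealD (J : ideal A) (f g : A) : f \in J -> g \in J -> f + g \in J.
Proof. exact: rpredD. Qed.

Lemma idealB (J : ideal A) (f g : A) : f \in J -> g \in J -> f - g \in J.
Proof. exact: rpredB. Qed.

Lemma idealNE (J : ideal A) (f : A) : (- f \in J) = (f \in J).
Proof. exact: (rpredN J f). Qed.

Lemma dim_leS (I J : {pred A}) d : {subset I <= J} -> dim_le I d -> dim_le J d.
Proof. by move=> IJ dI p pP Jp; apply: dI => // i f /IJ; exact: Jp. Qed.

Lemma eq_dim_le (I J : {pred A}) d : I =i J -> dim_le I d -> dim_le J d.
Proof. by move=> IJ; apply: dim_leS => f; rewrite IJ. Qed.

(** A chain of primes over the image of I contracts along u to a chain over I, and strict inclusions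
    stay strict because u is onto. *)
Lemma dim_le_pullback (u : {rmorphism A -> A}) (I : {pred A}) d :
  dim_le I d -> (forall f, exists g, u g = f) ->
  dim_le [pred f | `[< exists2 g, g \in I & f = u g >]] d.
Proof.
move=> dI sur p pP Ip pch; pose q i := [pred f | u f \in p i].
apply: (dI q) => [i|i f If|i j ij].
- have [[p0 p1 pD] pM] := pP i.
  split; first split; rewrite ?inE ?rmorph0 ?rmorph1 //.
    by move=> a x y; rewrite !inE rmorphD rmorphM; apply: pD.
  by move=> x y; rewrite !inE rmorphM; apply: pM.
- by rewrite inE; apply: Ip; rewrite inE; apply/asboolP; exists f.
- have [sub nsub] := pch i j ij.
  split=> [f|sub']; first by rewrite !inE; apply: sub.
  by apply: nsub => f; have [g <-] := sur f; apply: (sub' g).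
Qed.

Definition ann_elt M (x : M) : {pred A} := [pred f | f *: x == 0].

(** The smallest submodule that can witness membership of x is the cyclic one, and its annihilator
    is that of x. *)
Lemma mem_T_ M d (x : M) : (x \in T_ d M) <-> dim_le (ann_elt x) d.
Proof.
rewrite inE; split=> [/asboolP[N dN Nx]|dx].
  apply: dim_leS dN => f; rewrite !inE => /asboolP fN.
  by apply/eqP; apply: fN.
apply/asboolP; exists (cyclic x); last exact: mem_span.
apply: dim_leS dx => f; rewrite inE => /eqP fx.
by apply: annih_span => _ ->.
Qed.

Lemma sub_T_ M (N : submodule M) d : sub_dim_le N d -> {subset N <= T_ d M}.
Proof. by move=> dN x Nx; rewrite inE; apply/asboolP; exists N. Qed.

(** The preimage in A of T_d(A / J), so that torsion can be handled by ideals and monomials; for d =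
    1 it has the elements of [pure_part J]. *)
Definition lift_T (d : nat) (J : ideal A) : ideal A.
Proof.
apply: (@mk_submodule A^o (fun f => proj J f \in T_ d (quotm J))).
  by rewrite linear0 rpred0.
by move=> a x y Tx Ty; rewrite linearP rpredD // rpredZ.
Defined.

Lemma mem_lift_T d (J : ideal A) f :
  (f \in lift_T d J) <-> (proj J f \in T_ d (quotm J)).
Proof. exact: mk_submoduleP. Qed.

Lemma mem_lift_TP d (J : ideal A) (f : A) :
  (f \in lift_T d J) <-> dim_le [pred g : A | g * f \in J] d.
Proof.
rewrite mem_lift_T mem_T_; have e : ann_elt (proj J f) =i [pred g : A | g * f \in J].
  move=> g; rewrite !inE -projZ; apply/eqP/idP; by move/proj_eq0.
by split; apply: eq_dim_le => // g; rewrite e.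
Qed.

End LinearRelations.

(** * Monomial ideals and torus invariance *)

Section MonomialIdeals.
Variables (n : nat) (K : fieldType).
Local Notation A := {mpoly K[n]}.
Implicit Types (J : ideal A) (f : A) (m : 'X_{1..n}).

(** The substitution [twist] over any field; zero scalars are allowed and yield the coordinate
    primes below. *)
Definition rescale (t : 'I_n -> K) : A -> A :=
  comp_mpoly [tuple t i *: 'X_i | i < n].
HB.instance Definition _ t := GRing.RMorphism.on (rescale t).

Lemma rescaleX t m : rescale t 'X_[m] = (\prod_i t i ^+ m i) *: 'X_[m].
Proof.
rewrite /rescale comp_mpolyX [in RHS]mpolyXE_id -scaler_prod.
by apply: eq_bigr => i _; rewrite tnth_mktuple exprZn.
Qed.

Lemma mcoeff_rescale t f m : (rescale t f)@_m = (\prod_i t i ^+ m i) * f@_m.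
Proof.
elim/mpolyind: f => [|c k f _ _ ih]; first by rewrite rmorph0 mcoeff0 mulr0.
rewrite rmorphD mcoeffD ih mcoeffD mulrDr; congr (_ + _).
rewrite -mul_mpolyC rmorphM /= [X in X * _]comp_mpolyC rescaleX !mul_mpolyC !mcoeffZ mcoeffX.
by case: eqP => [->|_] /=; rewrite ?mulr0 ?mulr0 ?mulr1 // mulrC.
Qed.

Lemma rescaleK (t u : 'I_n -> K) : (forall i, t i * u i = 1) ->
  cancel (rescale u) (rescale t).
Proof.
move=> tu f; apply/mpolyP => m; rewrite !mcoeff_rescale mulrA -big_split /=.
by rewrite big1 ?mul1r // => i _; rewrite -exprMn tu expr1n.
Qed.

Definition monomial (J : {pred A}) : Prop :=
  forall f m, f \in J -> m \in msupp f -> 'X_[m] \in J.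

Lemma mem_monomials J f : {in msupp f, forall m, 'X_[m] \in J} -> f \in J.
Proof.
move=> h; rewrite (mpolyE f) big_seq; apply: rpred_sum => m /h mJ.
by rewrite -mul_mpolyC; apply: idealM.
Qed.

Lemma mem_X_le J m m' : (forall i, m i <= m' i)%N -> 'X_[m] \in J -> 'X_[m'] \in J.
Proof.
move=> le mJ; have -> : m' = (m' - m + m)%MM.
  by apply/mnmP => i; rewrite mnmDE mnmBE subnK.
by rewrite mpolyXD; apply: idealM.
Qed.

(** The prime generated by the variables in U, as the kernel of setting them to 0; it is prime
    because A is a domain. *)
Definition coord_prime (U : pred 'I_n) : {pred A} :=
  [pred f | rescale (fun i => (~~ U i)%:R) f == 0].

Lemma coord_primeP (U : pred 'I_n) f : reflect
  (forall m, m \in msupp f -> exists2 i, U i & m i != 0%N) (f \in coord_prime U).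
Proof.
rewrite inE; apply: (iffP eqP) => [f0 m mf|h].
  apply/not_exists2P => hU.
  have := mcoeff_rescale (fun i => (~~ U i)%:R) f m.
  rewrite f0 mcoeff0 big1 ?mul1r => [e|i _].
    by move: mf; rewrite mcoeff_msupp -e eqxx.
  case: (boolP (U i)) => Ui; last by rewrite expr1n.
  by case: (hU i) => [//|/negP/negPn/eqP ->].
apply/mpolyP => m; rewrite mcoeff_rescale mcoeff0.
case: (boolP (m \in msupp f)) => [/h[i Ui mi]|/memN_msupp_eq0 ->]; last by rewrite mulr0.
by rewrite (bigD1 i) //= Ui expr0n (negbTE mi) !mul0r.
Qed.

Lemma coord_prime_prime (U : pred 'I_n) : prime_ideal (coord_prime U).
Proof.
split; first split; rewrite ?inE ?rmorph0 ?rmorph1 ?eqxx ?oner_eq0 //.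
  by move=> a x y; rewrite !inE rmorphD rmorphM /= => /eqP -> /eqP ->; rewrite mulr0 addr0.
by move=> x y; rewrite !inE rmorphM mulf_eq0.
Qed.

(* Otherwise the primes generated by the variables outside S and the first k
   variables of S, for k <= d + 1, form a chain over J. *)
Lemma dim_le_monomial (J : {pred A}) d (S : {set 'I_n}) :
  monomial J -> dim_le J d -> #|S| = d.+1 ->
  exists2 m, 'X_[m] \in J & forall i, i \notin S -> m i = 0%N.
Proof.
move=> mJ dJ cS; apply/not_exists2P => hS.
pose U (k : nat) : pred 'I_n := [pred i | (i \notin S) || (index i (enum S) < k)%N].
apply: (dJ (fun k : 'I_d.+2 => coord_prime (U k))) => [k|k f fJ|k l kl].
- exact: coord_prime_prime.
- apply/coord_primeP => m mf; have mJm := mJ _ _ fJ mf.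
  case: (hS m) => [//|/existsNP[i /not_implyP[iS /eqP mi]]].
  by exists i => //; rewrite /U /= iS.
split=> [f /coord_primeP fk|].
  apply/coord_primeP => m /fk [i /orP[iS|ik] mi]; exists i => //; rewrite /U /=.
    by rewrite iS.
  by rewrite (leq_trans ik (ltnW kl)) orbT.
have kS : (k < size (enum S))%N by rewrite -cardE cS -ltnS (leq_trans _ (ltn_ord l)).
have [i0 _] : exists i0, i0 \in S by apply/set0Pn; rewrite -card_gt0 cS.
(* This variable has index k < l in S, so it lies in the l-th prime but not in the k-th: the chain
   is strict. *)
pose i := nth i0 (enum S) k.
have iS : i \in S by rewrite -mem_enum mem_nth.
have ik : index i (enum S) = k by rewrite index_uniq ?enum_uniq.
have Xl : 'X_i \in coord_prime (U l).
  apply/coord_primeP => m; rewrite msuppX inE => /eqP ->.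
  by exists i; rewrite ?mnm1E ?eqxx // /U /= ik kl orbT.
move=> /(_ _ Xl)/coord_primeP/(_ U_(i)%MM).
rewrite msuppX inE eqxx => /(_ isT)[j Uj].
rewrite mnm1E; case: (i =P j) => [ij _|_ //]; move: Uj.
by rewrite -ij /U /= iS ik ltnn.
Qed.

End MonomialIdeals.

(** * Local cohomology at the origin of monomial quotients *)

Section MoreMonomialIdeals.
Variables (n : nat) (K : fieldType).
Local Notation A := {mpoly K[n]}.
Implicit Types (J : ideal A) (f : A) (m : 'X_{1..n}) (i : 'I_n).

Lemma mem_msuppXnM i r f m : m \in msupp f -> (U_(i) *+ r + m)%MM \in msupp ('X_i ^+ r * f).
Proof. by rewrite mulrC mpolyXn !mcoeff_msupp mcoeffMX. Qed.

Lemma msuppXnM i r f m : m \in msupp ('X_i ^+ r * f) -> (r <= m i)%N.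
Proof.
rewrite mulrC mpolyXn (perm_mem (msuppMX _ _)) => /mapP[k _ ->].
by rewrite mnmDE mulmnE mnm1E eqxx mul1n leq_addr.
Qed.

Lemma nzd_monomial J i r f : monomial J ->
  (forall m, 'X_i ^+ r * 'X_[m] \in J -> 'X_[m] \in J) ->
  'X_i ^+ r * f \in J -> f \in J.
Proof.
move=> mJ nzd fJ; apply: mem_monomials => m mf; apply: nzd.
by rewrite mpolyXn -mpolyXD; apply: mJ fJ _; apply: mem_msuppXnM.
Qed.

Lemma monomial_sum J J' : monomial J -> monomial J' -> monomial (sum_sub J J').
Proof.
move=> mJ mJ' f m /mem_sum_ideal[g [h [-> gJ hJ']]] /msuppD_le.
rewrite mem_cat => /orP[mg|mh]; apply: mem_span; [left; exact: mJ mg|right; exact: mJ' mh].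
Qed.

Lemma mem_sumX J J' m : monomial J -> monomial J' ->
  'X_[m] \in sum_sub J J' -> 'X_[m] \in J \/ 'X_[m] \in J'.
Proof.
move=> mJ mJ' /mem_sum_ideal[g [h [e gJ hJ']]].
have : m \in msupp (g + h) by rewrite -e msuppX inE.
move=> /msuppD_le; rewrite mem_cat => /orP[mg|mh]; [left; exact: mJ mg|right; exact: mJ' mh].
Qed.

Definition cap_ideal J J' : ideal A.
Proof.
apply: (@mk_submodule _ A^o (fun f => f \in J /\ f \in J')).
  by split; apply: rpred0.
by move=> a x y [xJ xJ'] [yJ yJ']; split; apply: rpredD => //; apply: rpredZ.
Defined.

Lemma mem_cap J J' f : (f \in cap_ideal J J') <-> f \in J /\ f \in J'.
Proof. by rewrite inE; split=> /asboolP. Qed.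

(* The vanishing of the local cohomology H^0 and H^1 at the origin of A / J, in
   terms of Cech cochains of the punctured affine space. *)
Definition H0van (J : {pred A}) : Prop :=
  forall r f, (forall i, 'X_i ^+ r * f \in J) -> f \in J.

Definition H1van (J : {pred A}) : Prop :=
  forall r (h : 'I_n -> A),
    (forall i j, 'X_j ^+ r * h i - 'X_i ^+ r * h j \in J) ->
    exists f, forall i, h i - 'X_i ^+ r * f \in J.

Lemma eq_H1van (J J' : {pred A}) : J =i J' -> H1van J -> H1van J'.
Proof.
move=> e H r h hJ; have [i j|f fJ] := H r h; first by rewrite e.
by exists f => i; rewrite -e.
Qed.

(** Mayer-Vietoris. Primitives f and f' of one cochain modulo J and J' differ by an element of A /
    (J + J') supported at the origin, hence by 0, and can be corrected to a common primitive. *)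
Lemma H1van_cap J J' : H1van J -> H1van J' -> H0van (sum_sub J J') ->
  H1van (cap_ideal J J').
Proof.
move=> H H' H0 r h hJ.
have [i j|f fJ] := H r h; first by case/mem_cap: (hJ i j).
have [i j|f' fJ'] := H' r h; first by case/mem_cap: (hJ i j).
have : f - f' \in sum_sub J J'.
  apply: (H0 r) => i; apply/mem_sum_ideal.
  exists (- (h i - 'X_i ^+ r * f)), (h i - 'X_i ^+ r * f').
  split; rewrite ?idealNE //.
  by rewrite mulrBr opprB addrA subrK.
move=> /mem_sum_ideal[g [g' [e gJ gJ']]].
have e' : f - g = f' + g' by apply/eqP; rewrite subr_eq addrAC -addrA -e addrC subrK.
exists (f - g) => i; apply/mem_cap; split.
  by rewrite mulrBr opprB addrCA; apply: idealD => //; apply: idealM.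
by rewrite e' mulrDr opprD addrA; apply: idealB => //; apply: idealM.
Qed.

Lemma H0van_monomial J : monomial J ->
  (forall m, 'X_[m] \notin J -> exists i, forall r, 'X_i ^+ r * 'X_[m] \notin J) ->
  H0van J.
Proof.
move=> mJ h r f fJ; apply: mem_monomials => m mf; apply/negPn/negP => /h[i /(_ r)/negP].
by apply; rewrite mpolyXn -mpolyXD; apply: mJ (fJ i) _; apply: mem_msuppXnM.
Qed.

(** Every monomial of h a outside J is divisible by x_a^r: otherwise its multiple by x_b^r could not
    be cancelled by x_a^r h b in the cocycle relation, and x_b is a nonzerodivisor modulo J. *)
Lemma H1van_monomial J a b : monomial J -> a != b ->
  (forall r m, 'X_a ^+ r * 'X_[m] \in J -> 'X_[m] \in J) ->
  (forall r m, 'X_b ^+ r * 'X_[m] \in J -> 'X_[m] \in J) -> H1van J.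
Proof.
move=> mJ ab nzda nzdb r h hJ.
(* A primitive for the entry at a works at every i, since x_a^r is a nonzerodivisor modulo J. *)
suff [f fJ] : exists f, h a - 'X_a ^+ r * f \in J.
  exists f => i; apply: (nzd_monomial mJ (nzda r)).
  have -> : 'X_a ^+ r * (h i - 'X_i ^+ r * f) =
      ('X_a ^+ r * h i - 'X_i ^+ r * h a) + 'X_i ^+ r * (h a - 'X_a ^+ r * f).
    by rewrite !mulrBr mulrCA addrA subrK.
  by apply: idealD => //; apply: idealM.
(* The terms of h a outside J, divided by x_a^r; the truncated subtraction of exponents is exact by
   the divisibility shown below. *)
pose f := \sum_(m <- msupp (h a) | 'X_[m] \notin J) (h a)@_m *: 'X_[m - U_(a) *+ r].
exists f; rewrite [X in X - _](mpolyE (h a)) (bigID (fun m => 'X_[m] \in J)) /=.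
rewrite [X in _ + X - _](_ : _ = 'X_a ^+ r * f).
  rewrite addrK big_seq_cond; apply: rpred_sum => m /andP[_ mJ'].
  by rewrite -mul_mpolyC; apply: idealM.
rewrite mulr_sumr big_seq_cond [RHS]big_seq_cond; apply: eq_bigr => m /andP[mh mJ'].
rewrite -scalerAr mpolyXn -mpolyXD; congr (_ *: 'X_[_]).
rewrite addmC submK //; apply/mnm_lepP => i; rewrite mulmnE mnm1E.
case: eqP => [<-|_]; last by rewrite mul0n.
rewrite mul1n; apply: contraT => mr; case/negP: mJ'; apply: (nzdb r).
rewrite mpolyXn -mpolyXD; apply: mJ (hJ a b) _.
rewrite mcoeff_msupp mcoeffB [X in _ - X]memN_msupp_eq0 ?subr0.
  by rewrite -mcoeff_msupp mem_msuppXnM.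
apply/negP => /msuppXnM; rewrite mnmDE mulmnE mnm1E eq_sym (negbTE ab) mul0n.
by rewrite add0n; apply/negP.
Qed.

End MoreMonomialIdeals.

(** * Torus-invariant ideals in characteristic zero *)

Section Invariant.
Variables (n : nat) (K : numFieldType).
Local Notation A := {mpoly K[n]}.
Implicit Types (J : ideal A).

Definition invariant (J : {pred A}) : Prop :=
  forall t, (forall i, t i != 0) -> forall f, f \in J -> rescale t f \in J.

Lemma monomial_invariant J : monomial J -> invariant J.
Proof.
move=> mJ t _ f fJ; apply: mem_monomials => m mf; apply: mJ fJ _.
by apply: contraLR mf; rewrite !mcoeff_msupp mcoeff_rescale !negbK => /eqP ->; rewrite mulr0.
Qed.

(** Scaling by 2 a coordinate in which the exponents differ separates them, powers of 2 being
    distinct in characteristic zero. *)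
Lemma separating_torus (m m' : 'X_{1..n}) : m != m' ->
  exists2 t : 'I_n -> K, forall i, t i != 0 & \prod_i t i ^+ m i != \prod_i t i ^+ m' i.
Proof.
move=> mm'; have [i mi] : exists i, m i != m' i.
  apply/existsP; rewrite -negb_forall; apply: contra mm' => /forallP h.
  by apply/eqP/mnmP => i; apply/eqP.
exists (fun j => if j == i then 2%:R else 1) => [j|].
  by case: (j =P i) => _; rewrite ?oner_eq0 ?pnatr_eq0.
have E (k : 'X_{1..n}) : \prod_j (if j == i then 2%:R else 1 : K) ^+ k j = (2 ^ k i)%:R.
  rewrite (bigD1 i) //= eqxx big1 ?mulr1 ?natrX // => j /negbTE ->.
  by rewrite expr1n.
by rewrite !E eqr_nat eqn_exp2l.
Qed.

(* Subtracting t^m' f from t.f kills the monomial m' of f and keeps m. *)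
Lemma invariant_monomial J : invariant J -> monomial J.
Proof.
move=> iJ f m; have [k] := ubnP (size (msupp f)); elim: k f => // k ih f szf fJ mf.
have [[m' m'f /negP mm']|h] := pselect (exists2 m', m' \in msupp f & ~ m' == m).
  have [t t0 tm] := separating_torus mm'.
  pose c := \prod_i t i ^+ m' i; pose g := rescale t f - c%:MP * f.
  have gm k' : g@_k' = (\prod_i t i ^+ k' i - c) * f@_k'.
    by rewrite mcoeffB mcoeff_rescale mcoeffCM mulrBl.
  apply: (ih g); last 1 first.
  - by rewrite mcoeff_msupp gm mulf_neq0 -?mcoeff_msupp // subr_eq0 eq_sym.
  - apply: (@leq_trans (size (msupp f))); last by rewrite -ltnS.
    have /uniq_leq_size : uniq (m' :: msupp g).
      by rewrite /= msupp_uniq andbT mcoeff_msupp gm subrr mul0r eqxx.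
    apply=> k'; rewrite inE => /orP[/eqP -> //|]; rewrite !mcoeff_msupp gm.
    by apply: contra => /eqP ->; rewrite mulr0.
  - by apply: idealB; [apply: iJ|apply: idealM].
have -> : 'X_[m] = (f@_m)^-1%:MP * f.
  apply/mpolyP => m'; rewrite mcoeffX mcoeffCM; case: eqP => [<-|mm'].
    by rewrite mulVf // -mcoeff_msupp.
  rewrite [f@_m']memN_msupp_eq0 ?mulr0 //; apply/negP => m'f; apply: h.
  by exists m' => //; move=> /eqP/esym.
exact: idealM.
Qed.

End Invariant.

(** * Unions of coordinate planes *)

Section Planes.
Variable R : realType.
Local Notation C := R[i].
Local Notation A := {mpoly C[4]}.
Implicit Types (l : diagram) (f : A) (m : 'X_{1..4}) (a b i : 'I_4).

Lemma twistE t f : twist t f = rescale t f.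
Proof. by []. Qed.

Lemma mem_plane l a b f : f \in plane_ideal R l a b <->
  forall m, m \in msupp f -> forall c d : 'I_4, (c < d)%N -> uniq [:: a; b; c; d] ->
    (m c, m d) \notin part_set l.
Proof.
rewrite inE; split=> [/asboolP h m mf c d cd u|h].
  by apply: contraL mf => ml; rewrite -mcoeff_eq0 (h c d).
apply/asboolP => c d cd u m ml; apply: memN_msupp_eq0.
by apply: contraL ml => /h; apply.
Qed.

Lemma mem_planeX l a b m : 'X_[m] \in plane_ideal R l a b <->
  forall c d : 'I_4, (c < d)%N -> uniq [:: a; b; c; d] -> (m c, m d) \notin part_set l.
Proof.
rewrite mem_plane; split=> [|h k]; first by apply; rewrite msuppX inE.
by rewrite msuppX inE => /eqP ->.
Qed.

Lemma monomial_plane l a b : monomial (plane_ideal R l a b).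
Proof. by move=> f m /mem_plane h /h; rewrite mem_planeX. Qed.

(** The variables x_a and x_b are coordinates on the plane: multiplying by them leaves the exponents
    in the two normal directions unchanged. *)
Lemma plane_nzd l a b i r f : i \in [:: a; b] ->
  'X_i ^+ r * f \in plane_ideal R l a b -> f \in plane_ideal R l a b.
Proof.
move=> iab; apply: nzd_monomial; first exact: monomial_plane.
move=> m; rewrite mpolyXn -mpolyXD !mem_planeX => h c d cd u.
have := h c d cd u; rewrite !mnmDE !mulmnE !mnm1E.
have [-> ->] : (i == c) = false /\ (i == d) = false; last by rewrite !mul0n !add0n.
move: u iab; rewrite /= !inE !negb_or -!andbA => /and5P[_ ac ad bc /andP[bd _]].
by case/orP => /eqP ->; split; apply/negbTE.
Qed.

(** Strictly above both coordinates of every box, and 0 for the empty diagram. *)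
Definition bound l : nat := \max_(x <- part_set l) (maxn x.1 x.2).+1.

(** The index i is a normal direction of the plane, so m i is a coordinate of a box of l. *)
Lemma planeX_bound l a b m i : (a < b)%N -> i \notin [:: a; b] ->
  'X_[m] \notin plane_ideal R l a b -> (m i < bound l)%N.
Proof.
move=> ab iab /negP h; apply/negPn/negP => bi; apply: h; apply/mem_planeX => c d cd u.
apply/negP => ml; case/negP: bi.
have : (maxn (m c) (m d) < bound l)%N.
  exact: (@leq_bigmax_seq _ _ xpredT (fun x => (maxn x.1 x.2).+1) _ ml).
suff [->|->] : i = c \/ i = d by apply: leq_ltn_trans; rewrite leq_max leqnn ?orbT.
have : i \in [:: a; b; c; d].
  have /uniq_min_size : uniq [:: a; b; c; d] by [].
  have sub : {subset [:: a; b; c; d] <= enum 'I_4} by move=> x _; rewrite mem_enum.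
  by case/(_ _ sub); rewrite ?size_enum_ord // => _ ->; rewrite mem_enum.
move: iab; rewrite !inE negb_or => /andP[/negbTE -> /negbTE ->] /=.
by case/orP => /eqP; [left|right].
Qed.

Section Family.
Variable lam : 'I_4 -> 'I_4 -> diagram.
Implicit Types Q : rel 'I_4.

Lemma mem_planes Q f : f \in planes_ideal R lam Q <->
  forall a b, (a < b)%N -> Q a b -> f \in plane_ideal R (lam a b) a b.
Proof. by rewrite inE; split=> /asboolP. Qed.

Lemma monomial_planes Q : monomial (planes_ideal R lam Q).
Proof.
move=> f m /mem_planes h mf; apply/mem_planes => a b ab Qab.
exact: monomial_plane (h a b ab Qab) mf.
Qed.

Lemma notin_planes Q f : f \notin planes_ideal R lam Q ->
  exists a b, [/\ (a < b)%N, Q a b & f \notin plane_ideal R (lam a b) a b].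
Proof.
move=> /negP fN; apply: contrapT => h; apply: fN; apply/mem_planes => a b ab Qab.
by apply/negPn/negP => h'; apply: h; exists a, b.
Qed.

(** On each plane the variable x_a is a nonzerodivisor, so no section is supported at the origin. *)
Lemma H0van_planes Q : H0van (planes_ideal R lam Q).
Proof.
move=> r f h; apply/mem_planes => a b ab Qab.
apply: (@plane_nzd _ _ _ a r); first by rewrite inE eqxx.
by have /mem_planes := h a; apply.
Qed.

Lemma H1van_plane l a b : a != b -> H1van (plane_ideal R l a b).
Proof.
move=> ab; apply: (H1van_monomial (@monomial_plane _ _ _) ab) => r m;
  by apply: plane_nzd; rewrite !inE eqxx ?orbT.
Qed.

(* Mayer-Vietoris: adding a plane that shares a coordinate axis with each of the
   others, the intersection has a nonzerodivisor among the variables. *)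
Lemma H1van_planes_seq (s : seq ('I_4 * 'I_4)) :
  {in s, forall e, e.1 != e.2} ->
  {in s &, forall e e', exists2 i, i \in [:: e.1; e.2] & i \in [:: e'.1; e'.2]} ->
  H1van (planes_ideal R lam (fun a b => (a, b) \in s)).
Proof.
elim: s => [|[a b] s ih] sne shr.
  by move=> r h _; exists 0 => i; apply/mem_planes.
have [|ltab] := boolP (~~ (a < b)%N).
  move=> nab; apply: (@eq_H1van _ _ (planes_ideal R lam (fun a b => (a, b) \in s))).
    move=> f; apply/idP/idP => /mem_planes h; apply/mem_planes => c d cd.
      rewrite inE => /orP[/eqP[ca db]|]; last exact: h.
      by move: nab; rewrite -ca -db cd.
    by move=> sd; apply: h => //; rewrite inE sd orbT.
  apply: ih => [e es|e e' es es']; first by apply: sne; rewrite inE es orbT.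
  by apply: shr; rewrite inE ?es ?es' orbT.
rewrite negbK in ltab.
apply: (@eq_H1van _ _ (cap_ideal (plane_ideal R (lam a b) a b)
    (planes_ideal R lam (fun a b => (a, b) \in s)))).
  move=> f; apply/idP/idP => [/mem_cap[fab /mem_planes h]|/mem_planes h].
    apply/mem_planes => c d cd; rewrite inE => /orP[/eqP[-> ->] //|].
    exact: h.
  apply/mem_cap; split; first by apply: h; rewrite ?inE ?eqxx.
  by apply/mem_planes => c d cd sd; apply: h; rewrite ?inE ?sd ?orbT.
apply: H1van_cap.
- by apply: H1van_plane; apply: (sne (a, b)); rewrite inE eqxx.
- apply: ih => [e es|e e' es es']; first by apply: sne; rewrite inE es orbT.
  by apply: shr; rewrite inE ?es ?es' orbT.
have m1 := @monomial_plane (lam a b) a b.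
have m2 := @monomial_planes (fun a b => (a, b) \in s).
apply: H0van_monomial; first exact: monomial_sum.
move=> m mN; have [mN1 mN2] : 'X_[m] \notin plane_ideal R (lam a b) a b /\
    'X_[m] \notin planes_ideal R lam (fun a b => (a, b) \in s).
  by split; apply: contra mN => mJ; apply: mem_span; [left|right].
have [c [d [cd sd mNcd]]] := notin_planes mN2.
have [i iab icd] : exists2 i, i \in [:: a; b] & i \in [:: c; d].
  by apply: (shr (a, b) (c, d)); rewrite !inE ?eqxx ?sd ?orbT.
exists i => r; rewrite mpolyXn -mpolyXD; apply/negP => /(mem_sumX m1 m2)[].
  rewrite mpolyXD -mpolyXn => /(plane_nzd iab).
  exact/negP.
move=> /mem_planes/(_ c d cd sd); rewrite mpolyXD -mpolyXn => /(plane_nzd icd).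
exact/negP.
Qed.

Lemma H1van_planes (s : seq ('I_4 * 'I_4)) Q :
  (forall a b, (a < b)%N -> Q a b = ((a, b) \in s)) ->
  {in s, forall e, e.1 != e.2} ->
  {in s &, forall e e', exists2 i, i \in [:: e.1; e.2] & i \in [:: e'.1; e'.2]} ->
  H1van (planes_ideal R lam Q).
Proof.
move=> Qs ne shr; apply: eq_H1van (H1van_planes_seq ne shr) => f.
by apply/idP/idP => /mem_planes h; apply/mem_planes => a b ab; have := h a b ab; rewrite Qs.
Qed.

(** The six planes are split by whether they contain the x_4-axis; as a < b, only the second index
    can be the fourth. *)
Definition Q123 : rel 'I_4 := fun _ b => b != ord_max.
Definition Q4 : rel 'I_4 := fun _ b => b == ord_max.
Local Notation I123 := (planes_ideal R lam Q123).
Local Notation I4 := (planes_ideal R lam Q4).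
Local Notation IW := (W_ideal R lam).

(** Two 2-element subsets of the three indices below [ord_max] always meet, so any two of these
    planes share an axis. *)
Lemma H1van_I123 : H1van I123.
Proof.
pose s := [seq e : 'I_4 * 'I_4 <- [seq (a, b) | a <- enum 'I_4, b <- enum 'I_4]
          | (e.1 < e.2)%N && (e.2 != ord_max)].
have sE (a b : 'I_4) : ((a, b) \in s) = (a < b)%N && (b != ord_max).
  rewrite mem_filter; apply: andb_idr => _; apply/allpairsP.
  by exists (a, b); rewrite !mem_enum.
apply: (@H1van_planes s) => [a b ab|[a b]|[a b] [c d]]; rewrite ?sE ?ab //.
  by case/andP => /ltn_eqF ab _ /=; rewrite -val_eqE /= ab.
move=> /andP[ab b3] /andP[cd d3] /=.
have lt3 (k : 'I_4) : k != ord_max -> (k < 3)%N.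
  by rewrite -val_eqE /= => k3; rewrite ltn_neqAle k3 -ltnS ltn_ord.
move: (lt3 _ b3) (lt3 _ d3) => {}b3 {}d3.
have [->|ac] := eqVneq a c; first by exists c; rewrite inE eqxx.
have [->|ad] := eqVneq a d; first by exists d; rewrite !inE eqxx ?orbT.
have [->|bc] := eqVneq b c; first by exists c; rewrite !inE eqxx ?orbT.
have [->|bd] := eqVneq b d; first by exists d; rewrite !inE eqxx ?orbT.
exfalso; move: ab cd b3 d3 ac ad bc bd; rewrite -!val_eqE /=.
by case: a b c d => [[|[|[|a]]] ?] [[|[|[|b]]] ?] [[|[|[|c]]] ?] [[|[|[|d]]] ?].
Qed.

(** All three planes contain the x_4-axis. *)
Lemma H1van_I4 : H1van I4.
Proof.
pose s := [seq e : 'I_4 * 'I_4 <- [seq (a, b) | a <- enum 'I_4, b <- enum 'I_4]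
          | (e.1 < e.2)%N && (e.2 == ord_max)].
have sE (a b : 'I_4) : ((a, b) \in s) = (a < b)%N && (b == ord_max).
  rewrite mem_filter; apply: andb_idr => _; apply/allpairsP.
  by exists (a, b); rewrite !mem_enum.
apply: (@H1van_planes s) => [a b ab|[a b]|[a b] [c d]]; rewrite ?sE ?ab //.
  by case/andP => /ltn_eqF ab _ /=; rewrite -val_eqE /= ab.
move=> /andP[_ /eqP ->] /andP[_ /eqP ->] /=.
by exists ord_max; rewrite !inE eqxx orbT.
Qed.

Lemma monomial_W : monomial IW.
Proof. by apply: monomial_sum; apply: monomial_planes. Qed.

Lemma mem_planesT f : f \in planes_ideal R lam (fun _ _ => true) <->
  f \in I123 /\ f \in I4.
Proof.
split=> [/mem_planes h|[/mem_planes h3 /mem_planes h4]].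
  by split; apply/mem_planes => a b ab _; apply: h.
apply/mem_planes => a b ab _; case: (eqVneq b ord_max) => b3.
  by apply: h4; rewrite // /Q4 b3.
exact: h3.
Qed.

Definition W_bound : nat := \max_(x : 'I_4 * 'I_4) bound (lam x.1 x.2).

(* Were m i large, the plane of each half of W containing x^m would contain the
   x_i-axis, and x^m would not be torsion. *)
Lemma W_torsion_bound m : 'X_[m] \notin IW ->
  (forall i, exists r, 'X_i ^+ r * 'X_[m] \in IW) -> forall i, (m i < W_bound)%N.
Proof.
move=> mW tors i; have [r ri] := tors i.
have [m3 m4] : 'X_[m] \notin I123 /\ 'X_[m] \notin I4.
  by split; apply: contra mW => mJ; apply: mem_span; [left|right].
have [a [b [ab Qab mab]]] := notin_planes m3.
have [c [d [cd Qcd mcd]]] := notin_planes m4.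
have le_bound k j : (bound (lam k j) <= W_bound)%N.
  exact: (@leq_bigmax _ (fun x : 'I_4 * 'I_4 => bound (lam x.1 x.2)) (k, j)).
have [iab|iab] := boolP (i \in [:: a; b]); last first.
  exact: leq_trans (planeX_bound ab iab mab) _.
have [icd|icd] := boolP (i \in [:: c; d]); last first.
  exact: leq_trans (planeX_bound cd icd mcd) _.
move: ri; rewrite mpolyXn -mpolyXD => /(mem_sumX (@monomial_planes _) (@monomial_planes _)).
rewrite mpolyXD -mpolyXn; case.
  by move=> /mem_planes/(_ a b ab Qab)/(plane_nzd iab); rewrite (negbTE mab).
by move=> /mem_planes/(_ c d cd Qcd)/(plane_nzd icd); rewrite (negbTE mcd).
Qed.

End Family.
End Planes.

(** * Torsion of monomial quotients *)

Lemma uniform_exponent (T : eqType) (s : seq T) (P : T -> nat -> Prop) :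
  (forall x r r', (r <= r')%N -> P x r -> P x r') ->
  {in s, forall x, exists r, P x r} -> exists r, {in s, forall x, P x r}.
Proof.
move=> mono; elim: s => [|x s ih] h; first by exists 0%N.
have [r hr] := h x (mem_head x s).
have [|r' hr'] := ih; first by move=> y ys; apply: h; rewrite inE ys orbT.
exists (maxn r r') => y; rewrite inE => /orP[/eqP ->|/hr'].
  by apply: mono hr; rewrite leq_maxl.
by apply: mono; rewrite leq_maxr.
Qed.

Section Torsion.
Variables (n : nat) (K : numFieldType).
Local Notation A := {mpoly K[n]}.
Implicit Types (J : ideal A) (f : A) (m : 'X_{1..n}).

(** Scaling carries the multipliers of f into J to multipliers of its image, and [dim_le_pullback]
    keeps the dimension bound. *)
Lemma lift_T_invariant d J : invariant J -> invariant (lift_T d J).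
Proof.
move=> iJ t t0 f /mem_lift_TP dJ; apply/mem_lift_TP.
have u0 : forall i, (t i)^-1 != 0 by move=> i; rewrite invr_eq0.
have tu i : t i * (t i)^-1 = 1 by rewrite mulfV.
apply: (dim_leS _ (dim_le_pullback (u := rescale t) dJ _)) => g; last first.
  by exists (rescale (fun i => (t i)^-1) g); apply: rescaleK.
by rewrite !inE => /asboolP[h hf ->]; rewrite -rmorphM; apply: iJ.
Qed.

Lemma monomial_lift_T d J : monomial J -> monomial (lift_T d J).
Proof.
by move=> mJ; apply: invariant_monomial; apply: lift_T_invariant; apply: monomial_invariant.
Qed.

(** For each monomial of f, the multipliers into J form a monomial ideal of dimension at most d,
    which by [dim_le_monomial] contains a monomial in the d + 1 variables of S. A common exponent
    serves the finitely many monomials of f. *)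
Lemma lift_T_kill d J f (S : {set 'I_n}) : monomial J -> #|S| = d.+1 ->
  f \in lift_T d J -> exists r, \prod_(i in S) 'X_i ^+ r * f \in J.
Proof.
move=> mJ cS fT.
have [||r hr] := @uniform_exponent _ (msupp f)
    (fun m r => \prod_(i in S) 'X_i ^+ r * 'X_[m] \in J).
- move=> m r r' rr' h; have -> : \prod_(i in S) 'X_i ^+ r' =
      \prod_(i in S) 'X_i ^+ (r' - r) * \prod_(i in S) 'X_i ^+ r :> A.
    by rewrite -big_split /=; apply: eq_bigr => i _; rewrite -exprD subnK.
  by rewrite -mulrA; apply: idealM.
- move=> m mf; have /mem_lift_TP dm := monomial_lift_T mJ fT mf.
  have mI : monomial [pred g : A | g * 'X_[m] \in J].
    move=> g k; rewrite !inE => gJ kg; rewrite -mpolyXD; apply: mJ gJ _.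
    by rewrite mcoeff_msupp addmC mcoeffMX -mcoeff_msupp.
  have [k kJ kS] := dim_le_monomial mI dm cS.
  exists (\max_(i < n) k i); have -> : \prod_(i in S) 'X_i ^+ (\max_(i < n) k i) =
      \prod_(i in S) 'X_i ^+ (\max_(i < n) k i - k i) * 'X_[k] :> A.
    rewrite mpolyXE_id [X in _ * X](bigID (mem S)) /= [X in _ * (_ * X)]big1 ?mulr1.
      rewrite -big_split /=; apply: eq_bigr => i _.
      by rewrite -exprD subnK // (leq_bigmax i).
    by move=> i /kS ->; rewrite expr0.
  by rewrite -mulrA; apply: idealM.
exists r; apply: mem_monomials => m'; rewrite (mpolyE f) mulr_sumr.
move=> /msupp_sum_le; rewrite filter_predT => /flattenP[_ /mapP[m mf ->]].
rewrite -scalerAr => /msuppZ_le m'm; exact: mJ (hr m mf) m'm.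
Qed.

Lemma dim_le0_monomial (J : {pred A}) i :
  monomial J -> dim_le J 0 -> exists r, 'X_i ^+ r \in J.
Proof.
move=> mJ dJ; have [m mm mi] := dim_le_monomial mJ dJ (cards1 i).
exists (m i); suff <- : 'X_[m] = 'X_i ^+ m i :> A by [].
rewrite mpolyXE_id (bigD1 i) //= big1 ?mulr1 // => j ji.
by rewrite mi ?expr0 // inE.
Qed.

(** A prime over I contains all the variables, hence every polynomial without constant term; a
    strictly larger prime would contain a nonzero constant. *)
Lemma dim_le0_powers (I : {pred A}) r : (forall i, 'X_i ^+ r \in I) -> dim_le I 0.
Proof.
move=> Ir p pP Ip pch.
have [p0 p1] := (pP ord0, pP (lift ord0 ord0)).
have p_submod q : prime_ideal q -> submod_closed (q : {pred A^o}).
  by move=> [[q0 _ qD] _]; split=> // a x y xq yq; apply: qD.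
have [sub01 nsub] := pch ord0 (lift ord0 ord0) isT; apply: nsub => f f1.
have X0 i : 'X_i \in p ord0.
  have := Ip ord0 _ (Ir i); elim: r {Ir} => [|r ih].
    by rewrite expr0 => one; case: p0 => -[_ /negP].
  by rewrite exprS => /(proj2 p0)/orP[].
pose P0 : ideal A := Submodule (p_submod _ p0).
pose P1 : ideal A := Submodule (p_submod _ p1).
pose c := (f : A)@_0%MM.
have fc0 : (f : A) - c%:MP \in P0.
  apply: mem_monomials => m; rewrite mcoeff_msupp mcoeffB mcoeffC => mf.
  have [m0|m0] := eqVneq m 0%MM; first by rewrite m0 eqxx mulr1 subrr eqxx in mf.
  have [i mi] : exists i, m i != 0%N.
    apply/existsP; rewrite -negb_forall; apply: contra m0 => /forallP h.
    by apply/eqP/mnmP => i; rewrite mnm0E; apply/eqP.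
  apply: (@mem_X_le _ _ P0 U_(i)%MM m) => [j|]; last exact: X0.
  rewrite mnm1E.
  by case: (i =P j) => // <-; rewrite lt0n.
have [c0|c0] := eqVneq c 0; first by move: fc0; rewrite c0 mpolyC0 subr0.
have : f - ((f : A) - c%:MP) \in P1 by apply: idealB => //; apply: sub01.
rewrite opprB addrC subrK => /(idealM (c)^-1%:MP).
by rewrite -mpolyCM mulVf // => one; have [[_ /negP]] := p1.
Qed.

Lemma mem_lift_T0 J f : monomial J ->
  (f \in lift_T 0 J) <-> exists r, forall i, 'X_i ^+ r * f \in J.
Proof.
move=> mJ; split=> [fT|[r h]]; last by apply/mem_lift_TP; apply: (@dim_le0_powers _ r).
have [||r hr] := @uniform_exponent _ (enum 'I_n) (fun i r => 'X_i ^+ r * f \in J).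
- by move=> i r r' rr' h; rewrite -(subnK rr') exprD -mulrA; apply: idealM.
- move=> i _; have [r] := lift_T_kill mJ (cards1 i) fT.
  by rewrite big_set1; exists r.
by exists r => i; apply: hr; rewrite mem_enum.
Qed.

Lemma lift_T1_kill J f i j : monomial J -> i != j -> f \in lift_T 1 J ->
  exists r, 'X_i ^+ r * 'X_j ^+ r * f \in J.
Proof.
move=> mJ ij fT; have c2 : #|[set i; j]| = 2%N by rewrite cards2 ij.
have [r] := lift_T_kill mJ c2 fT.
by rewrite big_setU1 ?inE //= big_set1; exists r.
Qed.

Lemma H0van_lift_T0 J : monomial J -> H0van J -> {subset lift_T 0 J <= J}.
Proof. by move=> mJ H0 f /(mem_lift_T0 _ mJ)[r]; apply: H0. Qed.

End Torsion.

(** * Sections over the punctured affine space *)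

Section SectionsOffOrigin.
Variable R : realType.
Local Notation C := R[i].
Local Notation A := {mpoly C[4]}.
Implicit Types (f g : A) (m : 'X_{1..4}) (i j : 'I_4) (M : lmodType A).

(** No nonzero element is supported at the origin; homomorphisms into M are then determined by their
    Cech entries. *)
Definition torsion_free M : Prop :=
  forall r (x : M), (forall i, 'X_i ^+ r *: x = 0) -> x = 0.

Lemma torsion_free_quotm (J : ideal A) : H0van J -> torsion_free (quotm J).
Proof.
move=> H0 r; elim/quotm_ind => f fJ; apply/proj_eq0; apply: (H0 r) => i.
by apply/proj_eq0; rewrite projZ; apply: fJ.
Qed.

Lemma mdeg_origin f m : f \in @origin R -> m \in msupp f -> (0 < mdeg m)%N.
Proof.
rewrite inE lt0n mdeg_eq0 => /eqP f0; apply: contraL => /eqP ->.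
rewrite -mcoeff_eq0 -f0 mevalE (bigID (pred1 0%MM)) /= [X in _ + X]big1 ?addr0.
  rewrite -big_filter; case: (boolP (0%MM \in msupp f)) => m0.
    rewrite (perm_big [:: 0%MM]) /=; last first.
      by rewrite filter_pred1_uniq ?msupp_uniq.
    by rewrite big_seq1 big1 ?mulr1 // => i _; rewrite mnm0E expr0.
  rewrite big_filter big_seq_cond big1 ?memN_msupp_eq0 // => k /andP[kf /eqP k0].
  by rewrite k0 (negbTE m0) in kf.
move=> k /negP k0; have [i ki] : exists i, k i != 0%N.
  apply/existsP; rewrite -negb_forall; apply/negP => /forallP h; apply: k0.
  by apply/eqP/mnmP => i; rewrite mnm0E; apply/eqP.
by rewrite (bigD1 i) //= expr0n (negbTE ki) mul0r mulr0.
Qed.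

Lemma mdeg_prod_origin s (g : 'I_s -> A) m : (forall k, g k \in @origin R) ->
  m \in msupp (\prod_k g k) -> (s <= mdeg m)%N.
Proof.
elim: s g m => // s ih g m gO; rewrite big_ord_recl => /msuppM_le/allpairsP[[k l] /= [kg lg ->]].
rewrite mdegD -add1n leq_add //; first exact: mdeg_origin kg.
by apply: ih lg => k'; apply: gO.
Qed.

Definition power_ideal (r : nat) : ideal A.
Proof.
apply: (@mk_submodule _ A^o (fun f => exists g : 'I_4 -> A, f = \sum_i g i * 'X_i ^+ r)).
  by exists (fun=> 0); rewrite big1 // => i _; rewrite mul0r.
move=> a _ _ [g ->] [g' ->]; exists (fun i => a * g i + g' i).
rewrite scaler_sumr -big_split /=; apply: eq_bigr => i _.
by rewrite mulrDl -mulrA.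
Defined.

Lemma mem_power_ideal r f : (f \in power_ideal r) <->
  exists g : 'I_4 -> A, f = \sum_i g i * 'X_i ^+ r.
Proof. by rewrite inE; split=> /asboolP. Qed.

Lemma prod_origin_power r (g : 'I_(4 * r) -> A) : (forall k, g k \in @origin R) ->
  \prod_k g k \in power_ideal r.
Proof.
move=> gO; apply: mem_monomials => m /(mdeg_prod_origin gO) dm.
have [i ri] : exists i, (r <= m i)%N.
  (* Pigeonhole on four exponents with sum at least 4r; for r = 0 any index will do. *)
  case: r g gO dm => [|r] g gO dm; first by exists ord0.
  apply/existsP; rewrite -[X in is_true X]negbK negb_exists; apply/negP => /forallP h.
  have : (mdeg m <= \sum_(i < 4) r)%N.
    by rewrite mdegE; apply: leq_sum => i _; rewrite -ltnS ltnNge h.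
  rewrite sum_nat_const card_ord => /(leq_trans dm).
  by rewrite leq_pmul2l // ltnn.
have -> : m = (m - U_(i) *+ r + U_(i) *+ r)%MM.
  rewrite submK //; apply/mnm_lepP => j; rewrite mulmnE mnm1E.
  by case: (i =P j) => [<-|_]; rewrite ?mul1n ?mul0n.
rewrite mpolyXD -mpolyXn; apply: idealM; apply/mem_power_ideal.
exists (fun j => (j == i)%:R); rewrite (bigD1 i) //= eqxx mul1r big1 ?addr0 // => j /negbTE ->.
by rewrite mul0r.
Qed.

Variable I : ideal A.
Local Notation fil := (quot_pow_fil I (@origin R)).

Lemma mem_pow_X r i : proj I ('X_i ^+ r : A) \in fil r.
Proof.
apply: mem_span; exists (fun=> 'X_i); rewrite prodr_const card_ord; split=> // _.
by rewrite inE mevalXU.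
Qed.

Definition xpow r i : subm (fil r) := Subm (mem_pow_X r i).

Lemma projP (x : quotm I) : exists f : A, x = proj I f.
Proof. by elim/quotm_ind: x => f; exists f. Qed.

(** Both sides are the value of phi at the class of x_i^r f. Hence the values of phi at the x_i^r
    form a Cech cocycle. *)
Lemma hom_xpow M r (phi : {linear subm (fil r) -> M}) x f i : val x = proj I f ->
  'X_i ^+ r *: phi x = f *: phi (xpow r i).
Proof.
move=> xf; rewrite -!linearZ; congr (phi _); apply: val_inj.
by rewrite -[LHS]/(_ *: val x) -[RHS]/(_ *: proj I _) xf -!projZ mulrC.
Qed.

Lemma hom_xpow_eq M r (phi psi : {linear subm (fil r) -> M}) : torsion_free M ->
  (forall i, phi (xpow r i) = psi (xpow r i)) -> phi = psi.
Proof.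
move=> tf e; apply: hom_ext => x; have [f xf] := projP (val x).
apply/eqP; rewrite -subr_eq0; apply/eqP/(tf r) => i.
by rewrite scalerBr !(hom_xpow _ _ xf) e subrr.
Qed.

Lemma restr_xpow M r s (h : (r <= s)%N) (phi : {linear subm (fil r) -> M}) i :
  restr h phi (xpow s i) = 'X_i ^+ (s - r) *: phi (xpow r i).
Proof.
rewrite -linearZ /=; congr (phi _); apply: val_inj.
by rewrite -[RHS]/(_ *: proj I _) -projZ -exprD subnK.
Qed.

Lemma limhom_in_eq M r s n (phi : {linear subm (fil r) -> M})
    (psi : {linear subm (fil s) -> M}) : torsion_free M -> (r <= n)%N -> (s <= n)%N ->
  (forall i, 'X_i ^+ (n - r) *: phi (xpow r i) = 'X_i ^+ (n - s) *: psi (xpow s i)) ->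
  limhom_in phi = limhom_in psi.
Proof.
move=> tf rn sn e; apply/dl_in_eq; exists n, rn, sn => /=.
by apply: hom_xpow_eq => // i; rewrite !restr_xpow.
Qed.

Lemma limhom_in_eq0 M r (phi : {linear subm (fil r) -> M}) : limhom_in phi = 0 ->
  exists s (h : (r <= s)%N), restr h phi = 0.
Proof.
move=> e; have /dl_in_eqP[s [h]] : limhom_in phi = dl_in (0 : hom_sys fil M r).
  by rewrite e; exact/esym/(linear0 (@dl_in _ (hom_sys fil M) r)).
by rewrite linear0 => es; exists s, h.
Qed.

(** An element of m^s, for s = 4r, is represented by a sum of terms g_i x_i^r and is sent to the sum
    of the g_i b_i; torsion-freeness makes this independent of g. *)
Lemma limhom_ext M r (b : 'I_4 -> M) : torsion_free M ->
  (forall f (x : M), f \in I -> f *: x = 0) ->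
  (forall i j, 'X_j ^+ r *: b i = 'X_i ^+ r *: b j) ->
  exists s, (r <= s)%N /\ exists phi : {linear subm (fil s) -> M},
    forall i, phi (xpow s i) = 'X_i ^+ (s - r) *: b i.
Proof.
move=> tf IM cb; pose s := (4 * r)%N; have rs : (r <= s)%N by rewrite leq_pmull.
exists s; split=> //.
(* The value y is characterized without choosing g: it solves x_i^r y = f b_i for all i. *)
pose P (x : subm (fil s)) y := forall f, val x = proj I f ->
  forall i, 'X_i ^+ r *: y = f *: b i.
have PI x y f : val x = proj I f -> (forall i, 'X_i ^+ r *: y = f *: b i) -> P x y.
  move=> xf e g xg i; rewrite e -[f](subrK g) scalerDl IM ?add0r //.
  by apply/proj_eq; rewrite -xf.
have linP : linear_rel P.
  move=> a x x' y y' Pxy Pxy'.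
  have [f xf] := projP (val x); have [f' xf'] := projP (val x').
  apply: (PI _ _ (a * f + f')) => [|i].
    by rewrite -[LHS]/(a *: val x + val x') xf xf' -projZ -linearD.
  by rewrite scalerDr (scaler_swap ('X_i ^+ r)) (Pxy f) // (Pxy' f') // (scalerA a) scalerDl.
have totP x : exists y, P x y.
  have [f xf ] : exists2 f, val x = proj I f & f \in power_ideal r.
    have P0 : exists2 f, (0 : quotm I) = proj I f & f \in power_ideal r.
      by exists 0; [rewrite linear0|exact: ideal0].
    have PD a (y z : quotm I) : (exists2 f, y = proj I f & f \in power_ideal r) ->
        (exists2 f, z = proj I f & f \in power_ideal r) ->
        exists2 f, a *: y + z = proj I f & f \in power_ideal r.
      move=> [f -> fJ] [g -> gJ]; exists (a * f + g); last by apply/idealD/gJ/idealM.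
      by rewrite -projZ -linearD.
    apply/(mk_submoduleP P0 PD); apply: span_min (subm_valP x) => _ [g [gO ->]].
    by apply/mk_submoduleP; exists (\prod_k g k); rewrite // prod_origin_power.
  move=> /mem_power_ideal[g fg]; exists (\sum_i g i *: b i); apply: (PI _ _ f) => // i.
  rewrite fg scaler_sumr scaler_suml; apply: eq_bigr => j _.
  by rewrite (scaler_swap ('X_i ^+ r) (g j)) (cb j i) (scalerA (g j)).
have P0 y : P 0 y -> y = 0.
  by move=> P0y; apply: (tf r) => i; rewrite (P0y 0) ?linear0 // scale0r.
have [phi Pphi] := linear_of_rel linP totP P0.
exists phi => i; apply/eqP; rewrite -subr_eq0; apply/eqP/(tf r) => j.
rewrite scalerBr (Pphi _ ('X_i ^+ s)) // (scaler_swap ('X_j ^+ r)) (cb i j).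
by rewrite (scalerA ('X_i ^+ (s - r))) -exprD subnK // subrr.
Qed.

Lemma limhom_exact (T : submodule (quotm I)) :
  torsion_free (quotm I) -> torsion_free (quotm T) ->
  (forall x i j, x \in T -> i != j -> exists r, 'X_i ^+ r * 'X_j ^+ r *: x = 0) ->
  short_exact (limhom_map fil (incl T)) (limhom_map fil (proj T)).
Proof.
move=> tfI tfT killT; split.
- apply: (@dl_ind2 _ (hom_sys fil _)) => r phi psi.
  rewrite -!/(limhom_in _) /limhom_map /= !limhom_mapE => /dl_in_eqP[t [h e]].
  apply/dl_in_eq; exists t, h, h; apply: hom_ext => x; apply: val_inj.
  exact: (congr1 (fun f : {linear subm (fil t) -> quotm I} => f x) e).
- apply: (@dl_ind _ (hom_sys fil _)) => r phi; rewrite -!/(limhom_in _) /limhom_map /=.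
  rewrite limhom_mapE; split=> [/limhom_in_eq0[s [h e]]|[]].
    (* Restricted to m^s, phi takes its values in T and so factors through it. *)
    have phiT x : phi (fil_incl h x) \in T.
      apply/proj_eq0.
      exact: (congr1 (fun f : {linear subm (fil s) -> quotm T} => f x) e).
    pose psi_fun x : subm T := Subm (phiT x).
    have psi_lin : linear psi_fun by move=> a x y; apply: val_inj; rewrite /= !linearP.
    exists (limhom_in (linear_fun psi_lin)); rewrite limhom_mapE.
    apply/dl_in_eq; exists s, h, (leqnn s); apply: hom_ext => x /=.
    by congr (phi _); apply: val_inj.
  apply: (@dl_ind _ (hom_sys fil _)) => s psi; rewrite -!/(limhom_in _) limhom_mapE.
  move=> /dl_in_eq[t [h [k e]]].
  rewrite -[RHS](linear0 (@dl_in _ (hom_sys fil (quotm T)) t)).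
  rewrite -[LHS](@dl_in_tr _ (hom_sys fil _) _ _ h); congr dl_in; apply: hom_ext => x /=.
  have /= -> := congr1 (fun f : {linear subm (fil t) -> quotm I} => f x) e.
  by apply/proj_eq0; apply: subm_valP.
(* Surjectivity: the entries of phi are lifted to A / I, where the cocycle relation holds only up to
   T. *)
apply: (@dl_ind _ (hom_sys fil _)) => r phi; rewrite -!/(limhom_in _).
have /choice[a aE] : forall i, exists a, phi (xpow r i) = proj T a.
  by move=> i; elim/quotm_ind: (phi _) => a; exists a.
have pZ (c : A) y : proj T (c *: y) = c *: proj T y by exact: linearZ_LR.
have aT i j : 'X_j ^+ r *: a i - 'X_i ^+ r *: a j \in T.
  by apply/proj_eq; rewrite (pZ ('X_j ^+ r)) (pZ ('X_i ^+ r)) -(aE i) -(aE j); apply: hom_xpow.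
(* One exponent N kills the finitely many defects. *)
have [||N killN] := @uniform_exponent _ (enum {: 'I_4 * 'I_4}) (fun ij n => ij.1 != ij.2 ->
   'X_(ij.1) ^+ n * 'X_(ij.2) ^+ n *: ('X_(ij.2) ^+ r *: a ij.1 - 'X_(ij.1) ^+ r *: a ij.2) = 0).
- move=> ij n n' nn' e ne; rewrite -(subnK nn') !exprD mulrACA -scalerA e // scaler0 //.
- move=> ij _; have [e|ne] := eqVneq ij.1 ij.2; first by exists 0%N.
  by have [n e] := killT _ _ _ (aT ij.1 ij.2) ne; exists n.
(* These entries form a cocycle of level r + N, and the germ they define maps to that of phi. *)
pose b i := 'X_i ^+ N *: a i.
have cb i j : 'X_j ^+ (r + N) *: b i = 'X_i ^+ (r + N) *: b j.
  have [->//|ij] := eqVneq i j.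
  have := killN (i, j); rewrite mem_enum /= => /(_ isT ij) kill.
  by rewrite !exprD /b; apply: scaled_cocycle.
have [f x fI|s [rs [psi psiE]]] := limhom_ext tfI _ cb.
  elim/quotm_ind: x => x; rewrite -[LHS](projZ I f x); apply/proj_eq0.
  by rewrite mulrC; apply: idealM.
exists (limhom_in psi); rewrite /limhom_map /= limhom_mapE.
apply: (@limhom_in_eq _ _ _ s) => // [|i]; first exact: leq_trans (leq_addr _ _) rs.
rewrite subnn expr0 scale1r /= psiE aE -!linearZ /= scalerA -exprD; congr (proj T (_ ^+ _ *: _)).
by rewrite subnDA subnKC // (leq_subRL _ (leq_trans (leq_addr N r) rs)).
Qed.

End SectionsOffOrigin.

(** * The torus action and the comparison map *)

Section TorusAction.
Variable R : realType.
Local Notation C := R[i].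
Local Notation A := {mpoly C[4]}.
Implicit Types (f g : A) (m : 'X_{1..4}) (i j : 'I_4) (t : 'I_4 -> C).

Definition torus_inv t : 'I_4 -> C := fun i => (t i)^-1.

Lemma torus_invP t : torus t -> torus (torus_inv t).
Proof. by move=> t0 i; rewrite /torus_inv invr_eq0. Qed.

Lemma twistK t : torus t -> cancel (@twist R (torus_inv t)) (@twist R t).
Proof. by move=> t0; apply: rescaleK => i; rewrite /torus_inv mulfV. Qed.

Lemma twistD t : {morph @twist R t : f g / f + g}. Proof. exact: rmorphD. Qed.
Lemma twistB t : {morph @twist R t : f g / f - g}. Proof. exact: rmorphB. Qed.
Lemma twistM t : {morph @twist R t : f g / f * g}. Proof. exact: rmorphM. Qed.

Lemma twistC t (c : C) : twist t (c%:MP : A) = c%:MP.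
Proof. exact: comp_mpolyC. Qed.

Lemma twist_Xn t i r : twist t ('X_i ^+ r : A) = (t i ^+ r)%:MP * 'X_i ^+ r.
Proof.
rewrite mpolyXn twistE rescaleX mul_mpolyC; congr (_ *: _).
rewrite (bigD1 i) //= big1 => [|j ji]; rewrite mulmnE mnm1E ?eqxx ?mul1n ?mulr1 //.
by rewrite eq_sym (negbTE ji) mul0n expr0.
Qed.

Lemma act_quot_proj (J : ideal A) t f : invariant J -> torus t ->
  act_quot t (proj J f) = proj J (twist t f).
Proof.
move=> iJ t0; apply: quot_mapE; last exact: twistB.
by move=> g; apply: iJ.
Qed.

Lemma act_quot_semilinear (J : ideal A) t (a : A) (x y : quotm J) : invariant J -> torus t ->
  act_quot t (a *: x + y) = twist t a *: act_quot t x + act_quot t y.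
Proof.
move=> iJ t0; have [f ->] := projP x; have [g ->] := projP y.
rewrite -projZ -[X in act_quot _ X](linearD (proj J)) !act_quot_proj // twistD twistM.
by rewrite -projZ -[RHS](linearD (proj J)).
Qed.

Lemma act_quotB (J : ideal A) t : invariant J -> torus t ->
  {morph @act_quot R J t : x y / x - y}.
Proof.
move=> iJ t0 x y; have [f ->] := projP x; have [g ->] := projP y.
by rewrite -[X in act_quot _ X](linearB (proj J)) !act_quot_proj // twistB -[RHS](linearB (proj J)).
Qed.

Lemma act_quot_T (J : ideal A) t d x : invariant J -> torus t ->
  x \in T_ d (quotm J) -> act_quot t x \in T_ d (quotm J).
Proof.
move=> iJ t0; have [f ->] := projP x; rewrite act_quot_proj // => /mem_lift_T fT.
by apply/mem_lift_T; apply: lift_T_invariant.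
Qed.

Lemma act_quot_pow (J : ideal A) t r x : invariant J -> torus t ->
  x \in quot_pow J (@origin R) r -> act_quot t x \in quot_pow J (@origin R) r.
Proof.
move=> iJ t0 xr.
have P0 : act_quot t (0 : quotm J) \in quot_pow J (@origin R) r.
  by rewrite -[X in act_quot _ X](linear0 (proj J)) act_quot_proj // rmorph0 linear0 rpred0.
have PD a (y z : quotm J) : act_quot t y \in quot_pow J (@origin R) r ->
    act_quot t z \in quot_pow J (@origin R) r ->
    act_quot t (a *: y + z) \in quot_pow J (@origin R) r.
  move=> hy hz; rewrite (act_quot_semilinear a y z iJ t0).
  exact: (proj2 (sub_closed (quot_pow J (@origin R) r)) (twist t a) _ _ hy hz).
apply/(mk_submoduleP P0 PD); apply: span_min xr => _ [g [gO ->]].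
apply/mk_submoduleP; rewrite (act_quot_proj _ iJ t0); apply: mem_span.
exists (fun k => twist t (g k)); split; last by rewrite rmorph_prod.
move=> k; have := gO k; rewrite !inE => /eqP gk.
rewrite comp_mpoly_meval; apply/eqP; rewrite -[RHS]gk; apply: meval_eq => i.
by rewrite tnth_mktuple mevalZ mevalXU /= mulr0.
Qed.

End TorusAction.

Lemma cech_raise (A : comNzRingType) (J : ideal A) (x y f h : A) :
  h - y * f \in J -> x * h - x * y * f \in J.
Proof. by move=> hJ; rewrite -mulrA -mulrBr; apply: idealM. Qed.

Lemma cech_boundary (A : comNzRingType) (x y f u v : A) :
  x * u - y * v = y * (x * f - v) - x * (y * f - u).
Proof. by rewrite !mulrBr mulrCA opprB [RHS]addrC addrA subrK. Qed.

Lemma mem_T0_W (R : realType) lam (f : {mpoly R[i][4]}) :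
  (f \in lift_T 0 (W_ideal R lam)) <->
  exists r, forall i, 'X_i ^+ r * f \in W_ideal R lam.
Proof. by apply: mem_lift_T0; apply: monomial_W. Qed.

(** * The comparison map from germs to the torsion of O_W *)

Section ThetaMap.
Variable R : realType.
Local Notation C := R[i].
Local Notation A := {mpoly C[4]}.
Variables (I : ideal A) (lam : 'I_4 -> 'I_4 -> diagram).
Hypothesis mI : monomial I.
Hypothesis hlam : pure_part I =i planes_ideal R lam (fun _ _ => true).
Local Notation fil := (quot_pow_fil I (@origin R)).
Local Notation I123 := (planes_ideal R lam (@Q123)).
Local Notation I4 := (planes_ideal R lam (@Q4)).
Local Notation IW := (W_ideal R lam).
Implicit Types (f g h : A) (i j : 'I_4) (t : 'I_4 -> C).

Definition O_Z1_class f : O_Z1 I := proj (T_ 1 (quotm I)) (proj I f).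
Local Notation pp := O_Z1_class.

(** By [hlam], Z_1 is the union of the two halves, and its ideal the intersection of theirs. *)
Lemma O_Z1_class_eq0 f : pp f = 0 <-> f \in I123 /\ f \in I4.
Proof.
rewrite -mem_planesT -hlam; split=> [/proj_eq0|fT]; first by rewrite inE.
by apply/proj_eq0; rewrite inE in fT.
Qed.

Lemma O_Z1_classD f g : pp (f + g) = pp f + pp g.
Proof. by rewrite /O_Z1_class (linearD (proj I)) linearD. Qed.

Lemma O_Z1_classB f g : pp (f - g) = pp f - pp g.
Proof. by rewrite /O_Z1_class (linearB (proj I)) linearB. Qed.

Lemma O_Z1_classZ f g : pp (f * g) = f *: pp g.
Proof. by rewrite /O_Z1_class projZ; apply: linearZ_LR. Qed.

Lemma O_Z1_class_eq f g : pp f = pp g <-> f - g \in I123 /\ f - g \in I4.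
Proof.
rewrite -O_Z1_class_eq0 O_Z1_classB; split=> [->|/eqP]; first exact: subrr.
by rewrite subr_eq0 => /eqP.
Qed.

Lemma O_Z1_classP (x : O_Z1 I) : exists f, x = pp f.
Proof.
by elim/quotm_ind: x => y; have [f ->] := projP y; exists f.
Qed.

Lemma torsion_free_O_Z1 : torsion_free (O_Z1 I).
Proof.
move=> r x; have [f ->] := O_Z1_classP x => fX; apply/O_Z1_class_eq0.
split; apply: (@H0van_planes _ _ _ r) => i; have := fX i;
  by rewrite -O_Z1_classZ => /O_Z1_class_eq0[].
Qed.

Lemma act_Z1_class t f : torus t -> act_Z1 t (pp f) = pp (twist t f).
Proof.
move=> t0; have iI := monomial_invariant mI.
rewrite /act_Z1 quot_mapE ?act_quot_proj //; last exact: act_quotB.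
by move=> x; apply: act_quot_T.
Qed.

Lemma act_Z1_semilinear t (a : A) (x y : O_Z1 I) : torus t ->
  act_Z1 t (a *: x + y) = twist t a *: act_Z1 t x + act_Z1 t y.
Proof.
move=> t0; have [f ->] := O_Z1_classP x; have [g ->] := O_Z1_classP y.
rewrite -O_Z1_classZ -O_Z1_classD !act_Z1_class //.
by rewrite twistD twistM O_Z1_classD O_Z1_classZ.
Qed.

(* Mayer-Vietoris: phi is multiplication by f' on the first three planes and by
   f'' on the last three. *)
Definition glues r (phi : {linear subm (fil r) -> O_Z1 I}) (f' f'' : A) : Prop :=
  forall i, exists h, [/\ phi (xpow I r i) = pp h, h - 'X_i ^+ r * f' \in I123
    & h - 'X_i ^+ r * f'' \in I4].

Lemma glues_exists r (phi : {linear subm (fil r) -> O_Z1 I}) :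
  exists f' f'', glues phi f' f''.
Proof.
have /choice[h hE] : forall i, exists h, phi (xpow I r i) = pp h.
  by move=> i; apply: O_Z1_classP.
have cb i j : 'X_j ^+ r * h i - 'X_i ^+ r * h j \in I123 /\
              'X_j ^+ r * h i - 'X_i ^+ r * h j \in I4.
  by apply/O_Z1_class_eq; rewrite !O_Z1_classZ -!hE; apply: hom_xpow.
have [i j|f' f'P] := @H1van_I123 R lam r h; first by case: (cb i j).
have [i j|f'' f''P] := @H1van_I4 R lam r h; first by case: (cb i j).
by exists f', f'' => i; exists (h i).
Qed.

Lemma glues_restr r s (rs : (r <= s)%N) (phi : {linear subm (fil r) -> O_Z1 I}) f' f'' :
  glues phi f' f'' -> glues (restr rs phi) f' f''.
Proof.
move=> gphi i; have [h [hE h' h'']] := gphi i; exists ('X_i ^+ (s - r) * h).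
rewrite restr_xpow hE O_Z1_classZ -[in X in _ * _ - X * f'](subnK rs).
rewrite -[in X in _ * _ - X * f''](subnK rs) exprD.
by split; [|exact: cech_raise h'|exact: cech_raise h''].
Qed.

Lemma glues_linear r (phi psi : {linear subm (fil r) -> O_Z1 I}) a f' f'' g' g'' :
  glues phi f' f'' -> glues psi g' g'' ->
  glues (a *: phi + psi) (a * f' + g') (a * f'' + g'').
Proof.
move=> gphi gpsi i; have [h [hE h' h'']] := gphi i; have [k [kE k' k'']] := gpsi i.
exists (a * h + k); rewrite hom_addE hom_scaleE hE kE O_Z1_classD O_Z1_classZ.
have E (f g : A) : a * h + k - 'X_i ^+ r * (a * f + g) =
    a * (h - 'X_i ^+ r * f) + (k - 'X_i ^+ r * g).
  by rewrite mulrDr opprD addrACA mulrBr mulrCA.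
split; first by []; rewrite E.
  exact: idealD (idealM a h') k'.
exact: idealD (idealM a h'') k''.
Qed.

(** With [glues_linear], this makes f' and f'' unique modulo the ideals of their halves. *)
Lemma glues0 r f' f'' : glues (0 : {linear subm (fil r) -> O_Z1 I}) f' f'' ->
  f' \in I123 /\ f'' \in I4.
Proof.
move=> g0; split; apply: (@H0van_planes _ _ _ r) => i;
  have [h [/esym/O_Z1_class_eq0[h3 h4] h' h'']] := g0 i.
- by rewrite -['X_i ^+ r * f'](subKr h); apply: idealB.
- by rewrite -['X_i ^+ r * f''](subKr h); apply: idealB.
Qed.

(** The graph of the comparison map, which sends the germ of phi to f' - f''. *)
Definition theta_rel (x : limHom I (O_Z1 I)) (w : quotm IW) : Prop :=
  exists r (phi : {linear subm (fil r) -> O_Z1 I}) f' f'',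
    [/\ x = limhom_in phi, w = proj IW (f' - f'') & glues phi f' f''].

Lemma theta_rel_linear : linear_rel theta_rel.
Proof.
move=> a _ _ _ _ [r [phi [f' [f'' [-> -> gphi]]]]] [s [psi [g' [g'' [-> -> gpsi]]]]].
have [rn sn] := (leq_maxl r s, leq_maxr r s).
exists (maxn r s), (a *: restr rn phi + restr sn psi), (a * f' + g'), (a * f'' + g'').
split; last by apply: glues_linear; apply: glues_restr.
  rewrite -[limhom_in phi](@dl_in_tr _ (hom_sys fil _) _ _ rn).
  rewrite -[limhom_in psi](@dl_in_tr _ (hom_sys fil _) _ _ sn).
  exact/esym/(linearP (@dl_in _ (hom_sys fil (O_Z1 I)) (maxn r s))).
by rewrite -projZ -[LHS](linearD (proj IW)) mulrBr opprD addrACA.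
Qed.

Lemma theta_rel0 w : theta_rel 0 w -> w = 0.
Proof.
move=> [r [phi [f' [f'' [/esym/limhom_in_eq0[s [rs e]] -> gphi]]]]].
have := glues_restr rs gphi; rewrite e => /glues0[f3 f4].
apply/proj_eq0; apply/mem_sum_ideal; exists f', (- f''); split=> //.
by rewrite idealNE.
Qed.

(** Both x_i^r f' and x_i^r f'' are congruent to h i, each modulo its own ideal, and the two ideals
    add up to that of W. *)
Lemma W_ideal_power r f' f'' (h : 'I_4 -> A) :
  (forall i, h i - 'X_i ^+ r * f' \in I123 /\ h i - 'X_i ^+ r * f'' \in I4) ->
  f' - f'' \in lift_T 0 IW.
Proof.
move=> hJ; apply/mem_T0_W; exists r => i.
have [h' h''] := hJ i; apply/mem_sum_ideal.
exists (- (h i - 'X_i ^+ r * f')), (h i - 'X_i ^+ r * f''); split; rewrite ?idealNE //.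
by rewrite mulrBr opprB addrA subrK.
Qed.

Lemma theta_rel_T0 x w : theta_rel x w -> w \in T_ 0 (quotm IW).
Proof.
move=> [r [phi [f' [f'' [_ -> /choice[h hP]]]]]]; apply/mem_lift_T.
by apply: (@W_ideal_power r _ _ h) => i; case: (hP i).
Qed.

(** Functions on the two halves that agree on W come from one function f. *)
Lemma glue_one f' f'' : f' - f'' \in IW ->
  exists f, f' - f \in I123 /\ f'' - f \in I4.
Proof.
move=> /mem_sum_ideal[u [v [e uJ vJ]]]; exists (f' - u); rewrite subKr; split=> //.
have -> : f'' - (f' - u) = - v by rewrite -opprB addrAC e addrC addKr.
by rewrite idealNE.
Qed.

(** If f' and f'' agree on W, they glue to one f, and the germ is multiplication by f. *)
Lemma theta_rel_ker x : theta_rel x 0 <-> x \in cyclic (lim_one I).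
Proof.
have one1 : theta_rel (lim_one I) 0.
  exists 0%N, (proj (T_ 1 (quotm I)) \o incl _ : {linear _ -> _}), 1, 1.
  split=> // [|i]; first by rewrite subrr linear0.
  by exists 1; rewrite mulr1 subrr !ideal0.
split=> [[r [phi [f' [f'' [-> /esym/proj_eq0/glue_one[f [e' e'']] gphi]]]]]|].
  apply/mem_cyclic; exists f.
  rewrite -[f *: _](linearZ_LR (@dl_in _ (hom_sys fil _) 0) f).
  apply: (@limhom_in_eq _ _ _ _ _ r) => //; first exact: torsion_free_O_Z1.
  move=> i; rewrite subnn expr0 scale1r subn0.
  have [h [-> h' h'']] := gphi i.
  transitivity ('X_i ^+ r *: (f *: pp 1)); last by [].
  rewrite scaler_swap -(O_Z1_classZ ('X_i ^+ r) 1) -(O_Z1_classZ f) mulr1.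
  have E (g : A) : h - f * 'X_i ^+ r = h - 'X_i ^+ r * g + 'X_i ^+ r * (g - f).
    by rewrite mulrBr addrA subrK [f * _]mulrC.
  apply/O_Z1_class_eq; split; [rewrite (E f')|rewrite (E f'')];
    by apply: idealD => //; apply: idealM.
(* [linear_rel] provides a x + x' only, so a copy of [lim_one] is added and then subtracted. *)
move=> /mem_cyclic[a ->]; have := theta_rel_linear a one1 one1.
move=> /(theta_rel_linear (-1) one1); rewrite !scaler0 !addr0 scaleN1r.
by rewrite addrCA addNr addr0.
Qed.

(** For torsion f, each x_i^r f splits over the two ideals; the part u i in the second one equals
    x_i^r f on the first half and 0 on the second. The u i are the entries of a germ glued from f
    and 0. *)
Lemma theta_rel_onto w : w \in T_ 0 (quotm IW) -> exists x, theta_rel x w.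
Proof.
have [f ->] := projP w; move=> /mem_lift_T/mem_T0_W[r fW].
have /choice[u uP] : forall i, exists u : A, 'X_i ^+ r * f - u \in I123 /\ u \in I4.
  by move=> i; have /mem_sum_ideal[u [v [-> uJ vJ]]] := fW i; exists v; rewrite addrK.
have cb i j : 'X_j ^+ r *: pp (u i) = 'X_i ^+ r *: pp (u j).
  rewrite -!O_Z1_classZ; apply/O_Z1_class_eq; split; last first.
    by apply: idealB; apply: idealM; case: (uP i); case: (uP j).
  have -> : 'X_j ^+ r * u i - 'X_i ^+ r * u j =
      'X_i ^+ r * ('X_j ^+ r * f - u j) - 'X_j ^+ r * ('X_i ^+ r * f - u i).
    exact: cech_boundary.
  by apply: idealB; apply: idealM; [case: (uP j)|case: (uP i)].
have IM g (x : O_Z1 I) : g \in I -> g *: x = 0.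
  have [h ->] := O_Z1_classP x => gI; rewrite -O_Z1_classZ /O_Z1_class.
  have /proj_eq0 -> : g * h \in I by rewrite mulrC; apply: idealM.
  exact: linear0.
have [s [rs [phi phiE]]] := limhom_ext torsion_free_O_Z1 IM cb.
exists (limhom_in phi), s, phi, f, 0; split=> //; first by rewrite subr0.
move=> i; exists ('X_i ^+ (s - r) * u i); rewrite phiE O_Z1_classZ mulr0 subr0.
have [u3 u4] := uP i; split=> //; last exact: idealM.
have -> : 'X_i ^+ s = 'X_i ^+ (s - r) * 'X_i ^+ r :> A by rewrite -exprD subnK.
by apply: cech_raise; rewrite -idealNE opprB.
Qed.

End ThetaMap.

(** * Equivariance of the comparison map *)

Section ThetaEquivariance.
Variable R : realType.
Local Notation C := R[i].
Local Notation A := {mpoly C[4]}.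
Variables (I : ideal A) (lam : 'I_4 -> 'I_4 -> diagram).
Hypothesis mI : monomial I.
Hypothesis hlam : pure_part I =i planes_ideal R lam (fun _ _ => true).
Local Notation fil := (quot_pow_fil I (@origin R)).
Local Notation I123 := (planes_ideal R lam (@Q123)).
Local Notation I4 := (planes_ideal R lam (@Q4)).
Local Notation IW := (W_ideal R lam).
Local Notation pp := (@O_Z1_class R I).
Implicit Types (f g h : A) (i j : 'I_4) (t : 'I_4 -> C).

Definition act_pow t r : subm (fil r) -> subm (fil r) := Defs.sub_map (@act_quot R I t).

Lemma act_powE t r (x : subm (fil r)) : torus t -> val (act_pow t x) = act_quot t (val x).
Proof.
move=> t0; apply: sub_mapE => y; apply: act_quot_pow => //.
exact: monomial_invariant.
Qed.

Lemma act_pow_semilinear t r (a : A) (x y : subm (fil r)) : torus t ->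
  act_pow t (a *: x + y) = twist t a *: act_pow t x + act_pow t y.
Proof.
move=> t0; apply: val_inj; rewrite act_powE //.
rewrite -[RHS]/(twist t a *: val (act_pow t x) + val (act_pow t y)) !act_powE //.
exact: (act_quot_semilinear a (val x) (val y) (monomial_invariant mI) t0).
Qed.

Lemma act_pow_xpow t r i : torus t ->
  act_pow t (xpow I r i) = (t i ^+ r)%:MP *: xpow I r i.
Proof.
move=> t0; apply: val_inj; rewrite act_powE //.
rewrite -[LHS]/(act_quot t (proj I ('X_i ^+ r : A))).
rewrite (act_quot_proj _ (monomial_invariant mI) t0) twist_Xn projZ.
by [].
Qed.

Lemma act_hom t r (phi : {linear subm (fil r) -> O_Z1 I}) : torus t ->
  exists psi : {linear subm (fil r) -> O_Z1 I},
    forall x, psi x = act_Z1 t (phi (act_pow (torus_inv t) x)).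
Proof.
move=> t0; have t'0 := torus_invP t0.
have lin : linear (fun x => act_Z1 t (phi (act_pow (torus_inv t) x))).
  move=> a x y; rewrite (act_pow_semilinear _ _ _ t'0) linearP.
  by rewrite (act_Z1_semilinear mI _ _ _ t0) twistK.
by exists (linear_fun lin).
Qed.

Lemma glues_act t r (phi psi : {linear subm (fil r) -> O_Z1 I}) f' f'' : torus t ->
  (forall x, psi x = act_Z1 t (phi (act_pow (torus_inv t) x))) ->
  glues lam phi f' f'' -> glues lam psi (twist t f') (twist t f'').
Proof.
move=> t0 psiE gphi i; have [h [hE h' h'']] := gphi i; have t'0 := torus_invP t0.
(* The factor by which the inverse torus element scales x_i^r; it cancels the one produced by
   [twist t]. *)
pose c : C := torus_inv t i ^+ r; exists (c%:MP * twist t h).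
have E f : c%:MP * twist t h - 'X_i ^+ r * twist t f = c%:MP * twist t (h - 'X_i ^+ r * f).
  rewrite twistB twistM twist_Xn mulrBr -(mulrA (t i ^+ r)%:MP) (mulrA c%:MP) -mpolyCM.
  by rewrite /c /torus_inv -exprMn mulVf // expr1n mpolyC1 mul1r.
split.
- rewrite psiE act_pow_xpow // linearZ_LR hE -O_Z1_classZ act_Z1_class //.
  by rewrite twistM twistC.
- by rewrite E; apply: idealM; apply: monomial_invariant t0 _ h'; apply: monomial_planes.
- by rewrite E; apply: idealM; apply: monomial_invariant t0 _ h''; apply: monomial_planes.
Qed.

Lemma theta_rel_act t (x : limHom I (O_Z1 I)) (w : quotm IW) : torus t -> theta_rel x w ->
  theta_rel (act_limHom_Z1 t x) (act_quot t w).
Proof.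
(* [act_limHom_Z1] is computed on the chosen representative of x, so the relation is shown for that
   one and transferred by uniqueness. *)
move=> t0 xw; pose r := tag (repr (x : dirlim _)).
pose phi : {linear subm (fil r) -> O_Z1 I} := tagged (repr (x : dirlim _)).
have xE : x = limhom_in phi by rewrite /limhom_in dl_reprP.
have [f' [f'' gphi]] := glues_exists hlam phi.
have xw' : theta_rel x (proj IW (f' - f'')) by exists r, phi, f', f''.
rewrite (linear_rel_inj (@theta_rel_linear R I lam) (theta_rel0 hlam) xw xw').
have iW : invariant IW by apply: monomial_invariant; apply: monomial_W.
rewrite (@act_quot_proj R IW t (f' - f'') iW t0) twistB.
have [psi psiE] := act_hom phi t0.
exists r, psi, (twist t f'), (twist t f''); split=> //.
  by rewrite -(hom_mapE psiE).
exact: glues_act gphi.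
Qed.

Lemma theta_exists : exists Theta : {linear limHom_mod I -> T0W R lam},
  bijective Theta /\ forall t, torus t -> forall x,
    Theta (act_limHom_mod t x) = act_T0W t (Theta x).
Proof.
pose P (x : limHom I (O_Z1 I)) (w : T0W R lam) := theta_rel x (val w).
have linP : linear_rel P.
  by move=> a x x' y y'; apply: theta_rel_linear.
have totP x : exists w, P x w.
  elim/dl_ind: x => r phi; have [f' [f'' gphi]] := glues_exists hlam phi.
  have xw : theta_rel (limhom_in phi) (proj IW (f' - f'')) by exists r, phi, f', f''.
  by exists (Subm (theta_rel_T0 xw)).
have P0 w : P 0 w -> w = 0.
  by move=> /(theta_rel0 hlam) w0; apply: val_inj.
have [Th PTh] := linear_of_rel linP totP P0.
have v0 : val (0 : T0W R lam) = 0 by exact: (linear0 (incl _)).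
have ker x : Th x = 0 <-> x \in cyclic (lim_one I).
  rewrite -(theta_rel_ker hlam); split=> [e|xw]; first by have := PTh x; rewrite /P e v0.
  by apply: (linear_rel_inj linP P0 (PTh x)); rewrite /P v0.
have sur w : exists x, Th x = w.
  have [x xw] := theta_rel_onto hlam (subm_valP w).
  by exists x; apply: (linear_rel_inj linP P0 (PTh x)).
have [G [bijG GE]] := quotm_first_iso ker sur.
exists G; split=> // t t0 z; rewrite -[X in act_T0W t (G X)](reprK z).
rewrite -[X in act_T0W t (G X)]/(proj _ (repr z)) GE.
rewrite /act_limHom_mod /quot_map GE.
apply: (linear_rel_inj linP P0 (PTh _)); rewrite /P.
rewrite (_ : val _ = act_quot t (val (Th (repr z)))); first exact: theta_rel_act (PTh _).
apply: sub_mapE => y; apply: act_quot_T => //.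
by apply: monomial_invariant; apply: monomial_W.
Qed.

End ThetaEquivariance.

(** * Torus-fixed pairs *)

Section FixedPairs.
Variable R : realType.
Local Notation C := R[i].
Local Notation A := {mpoly C[4]}.
Variable Q : pair R.
Local Notation F := (pair_mod Q).
Local Notation s := (pair_sec Q).
Implicit Types (f g h : A) (i j : 'I_4) (t : 'I_4 -> C) (y : F).

Lemma mem_pair_supp f : (f \in pair_supp Q) <-> forall y, f *: y = 0.
Proof.
rewrite inE; split=> [/asboolP h y|h]; first exact: h.
by apply/asboolP => y _; apply: h.
Qed.

Lemma mem_coker_supp f : (f \in supp_ideal (quotm (cyclic s))) <->
  forall y, exists a, f *: y = a *: s.
Proof.
have pZ y : f *: proj (cyclic s) y = proj (cyclic s) (f *: y).
  exact/esym/linearZ_LR.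
rewrite inE; split=> [/asboolP h y|h].
  apply/mem_cyclic/proj_eq0; rewrite -pZ.
  exact: h.
apply/asboolP => z _; elim/quotm_ind: z => y.
by rewrite [LHS]pZ; apply/proj_eq0/mem_cyclic; apply: h.
Qed.

Hypothesis hQ : PT0_pair Q.

Lemma PT0_torsion_free : torsion_free F.
Proof.
move=> r y yX; apply: (PT0_pure hQ (N := cyclic y)); last exact: mem_span.
apply: (@dim_le0_powers _ _ _ r) => i; apply: annih_span => _ ->; exact: yX.
Qed.

(** If f s = 0, then f F is killed by the annihilator of the cokernel of s, so it is 0-dimensional
    and vanishes by purity. *)
Lemma mem_pair_suppE f : (f \in pair_supp Q) <-> f *: s = 0.
Proof.
rewrite mem_pair_supp; split=> [->//|fs y].
pose N := Defs.span (fun z : F => exists y, z = f *: y).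
apply: (PT0_pure hQ (N := N)); last by apply: mem_span; exists y.
apply: dim_leS (PT0_coker hQ) => g /mem_coker_supp gJ.
apply: annih_span => _ [z ->]; have [a gz] := gJ z.
by rewrite scaler_swap gz scaler_swap fs scaler0.
Qed.

Hypothesis hT : T_fixed Q.

Lemma semilinearZ t (u : {linear F -> F | twist t \; *:%R}) (a : A) y :
  u (a *: y) = twist t a *: u y.
Proof. by rewrite linearZ. Qed.

Lemma pair_supp_invariant : invariant (pair_supp Q).
Proof.
move=> t t0 f /mem_pair_supp fF; apply/mem_pair_supp => y.
have [u [[v vK uK] _]] := hT t0.
by rewrite -(uK y) -[LHS](semilinearZ u f (v y)) fF linear0.
Qed.

Lemma pair_supp_monomial : monomial (pair_supp Q).
Proof. exact: invariant_monomial pair_supp_invariant. Qed.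

Lemma pair_supp_H0van : H0van (pair_supp Q).
Proof.
move=> r f fX; apply/mem_pair_suppE; apply: (PT0_torsion_free (r := r)) => i.
by rewrite scalerA; apply/mem_pair_suppE.
Qed.

Lemma coker_supp_invariant : invariant (supp_ideal (quotm (cyclic s))).
Proof.
move=> t t0 f /mem_coker_supp fJ; apply/mem_coker_supp => y.
have [u [[v vK uK] us]] := hT t0; have [a fa] := fJ (v y).
exists (twist t a); rewrite -(uK y) -[LHS](semilinearZ u f (v y)) fa.
by rewrite semilinearZ us.
Qed.

Lemma coker_power : exists r, forall i y, exists h, 'X_i ^+ r *: y = h *: s.
Proof.
have mJ := invariant_monomial coker_supp_invariant.
have [||r hr] := @uniform_exponent _ (enum 'I_4)
    (fun i r => 'X_i ^+ r \in supp_ideal (quotm (cyclic s))).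
- by move=> i r r' rr' h; rewrite -(subnK rr') exprD; apply: idealM.
- by move=> i _; apply: dim_le0_monomial mJ (PT0_coker hQ).
by exists r => i; apply/mem_coker_supp; apply: hr; rewrite mem_enum.
Qed.

End FixedPairs.

(** * Submodules of the torsion of O_W *)

Section TorsionSubmodules.
Variable R : realType.
Local Notation C := R[i].
Local Notation A := {mpoly C[4]}.
Variable lam : 'I_4 -> 'I_4 -> diagram.
Local Notation IW := (W_ideal R lam).
Local Notation T0W := (T0W R lam).
Implicit Types (f g h : A) (i j : 'I_4) (t : 'I_4 -> C) (K : submodule T0W) (w : T0W).
Implicit Types (m : 'X_{1..4}).

Lemma T0W_of f : f \in lift_T 0 IW -> exists w, val w = proj IW f.
Proof. by move=> /mem_lift_T fT; exists (Subm fT). Qed.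

Lemma T0W_rep w : exists2 f, val w = proj IW f & f \in lift_T 0 IW.
Proof.
have [f wf] := projP (val w); exists f => //.
by apply/mem_lift_T; rewrite -wf; apply: subm_valP.
Qed.

Lemma T0W_valD (a : A) w w' : val (a *: w + w') = a *: val w + val w'.
Proof. exact: (linearP (incl _)). Qed.

Lemma T0W_val0 : val (0 : T0W) = 0. Proof. exact: (linear0 (incl _)). Qed.

(** The preimage of K in A. Submodules of T_0(O_W) become ideals containing that of W, and
    torus-invariant ones become monomial ideals. *)
Definition T0W_lift K : ideal A.
Proof.
apply: (@mk_submodule _ A^o (fun f => exists2 w, w \in K & val w = proj IW f)).
  by exists 0; rewrite ?rpred0 // T0W_val0 linear0.
move=> a f g [w wK wf] [w' wK' wg]; exists (a *: w + w').
  exact: (proj2 (sub_closed K) a _ _ wK wK').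
by rewrite T0W_valD wf wg; apply/esym/(linearP (proj IW)).
Defined.

Lemma mem_T0W_liftE K f : (f \in T0W_lift K) <-> exists2 w, w \in K & val w = proj IW f.
Proof. by rewrite inE; split=> /asboolP. Qed.

Lemma mem_T0W_lift K w f : val w = proj IW f -> (w \in K) <-> (f \in T0W_lift K).
Proof.
move=> wf; rewrite mem_T0W_liftE; split=> [wK|[w' wK wf']]; first by exists w.
by rewrite (val_inj (etrans wf (esym wf'))).
Qed.

Lemma sub_W_lift K : {subset IW <= T0W_lift K}.
Proof.
move=> f /proj_eq0 f0; apply/mem_T0W_liftE; exists 0; first exact: rpred0.
by rewrite f0 T0W_val0.
Qed.

Lemma lift_sub_T0 K : {subset T0W_lift K <= lift_T 0 IW}.
Proof.
move=> f /mem_T0W_liftE[w _ wf]; apply/mem_lift_T; rewrite -wf; exact: subm_valP.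
Qed.

Lemma invariant_W : invariant IW.
Proof. by apply: monomial_invariant; apply: monomial_W. Qed.

Lemma monomial_T0W : monomial (lift_T 0 IW).
Proof. by apply: monomial_lift_T; apply: monomial_W. Qed.

Lemma val_act_T0W t w f : torus t -> val w = proj IW f ->
  val (act_T0W t w) = proj IW (twist t f).
Proof.
move=> t0 wf; rewrite -(act_quot_proj f invariant_W t0) -wf.
by apply: sub_mapE => y; apply: act_quot_T => //; apply: invariant_W.
Qed.

Lemma T0W_lift_monomial K :
  (forall t, torus t -> forall w, w \in K -> act_T0W t w \in K) -> monomial (T0W_lift K).
Proof.
move=> Kt; apply: invariant_monomial => t t0 f /mem_T0W_liftE[w wK wf].
apply/mem_T0W_liftE; exists (act_T0W t w); first exact: Kt.
exact: val_act_T0W.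
Qed.

Lemma T0_bound m i : 'X_[m] \in lift_T 0 IW -> 'X_[m] \notin IW -> (m i < W_bound lam)%N.
Proof.
move=> /mem_T0_W[r rW] mW.
by apply: W_torsion_bound mW _ _ => j; exists r.
Qed.

Lemma T0_power f i : f \in lift_T 0 IW -> 'X_i ^+ W_bound lam * f \in IW.
Proof.
move=> fT; rewrite (mpolyE f) mulr_sumr big_seq; apply: (rpred_sum (S := IW)) => m mf.
rewrite -scalerAr -mul_mpolyC; apply: idealM.
apply: contraT => mW; have mT := monomial_T0W fT mf.
rewrite mpolyXn -mpolyXD in mW; have := T0_bound i _ mW.
rewrite mnmDE mulmnE mnm1E eqxx mul1n ltnNge leq_addr; apply.
by rewrite mpolyXD; apply: idealM.
Qed.

Local Notation bmon := 'X_{1..4 < (4 * W_bound lam).+1}.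

(** Four exponents below [W_bound] bound the degree, so only finitely many monomials are nonzero in
    T_0(O_W). *)
Lemma T0_bmon m : 'X_[m] \in lift_T 0 IW -> 'X_[m] \notin IW ->
  exists b : bmon, m = b.
Proof.
move=> mT mW; have dm : (mdeg m < (4 * W_bound lam).+1)%N.
  rewrite ltnS mdegE -[X in (_ <= X * _)%N]card_ord -sum_nat_const.
  by apply: leq_sum => i _; apply: ltnW; apply: T0_bound.
by exists (BMultinom dm).
Qed.

(** The torsion condition stands behind the quantifier so that [choice] gives a total function, with
    default 0. *)
Lemma T0W_X m : exists w, 'X_[m] \in lift_T 0 IW -> val w = proj IW 'X_[m].
Proof.
have [mT|_] := boolP ('X_[m] \in lift_T 0 IW); last by exists 0.
by have [w wm] := T0W_of mT; exists w.
Qed.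

Definition lift_mon K : {set bmon} := [set b : bmon | 'X_[b] \in T0W_lift K].

Definition mon_span (S : {set bmon}) : submodule T0W :=
  Defs.span (fun w => exists2 b : bmon, b \in S & val w = proj IW 'X_[b]).

Lemma T0W_decomp w f : val w = proj IW f -> f \in lift_T 0 IW ->
  exists wm : 'X_{1..4} -> T0W, (forall m, m \in msupp f -> val (wm m) = proj IW 'X_[m])
    /\ w = \sum_(m <- msupp f) (f@_m)%:MP *: wm m.
Proof.
move=> wf fT; have [wm wmP] := choice T0W_X; exists wm.
have wmE m : m \in msupp f -> val (wm m) = proj IW 'X_[m].
  by move=> mf; apply: wmP; apply: monomial_T0W mf.
split=> //; apply: val_inj; rewrite wf [in LHS](mpolyE f).
rewrite [RHS](linear_sum (incl _)) [LHS](linear_sum (proj IW)) /=.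
rewrite big_seq [RHS]big_seq; apply: eq_bigr => m mf.
by rewrite -mul_mpolyC projZ -wmE.
Qed.

(** The preimage of K is monomial, so K is spanned by classes of monomials, and the nonzero ones lie
    in a fixed finite set. *)
Lemma mon_spanE K : (forall t, torus t -> forall w, w \in K -> act_T0W t w \in K) ->
  K =i mon_span (lift_mon K).
Proof.
move=> Kt w; have mK := T0W_lift_monomial Kt; apply/idP/idP => wK; last first.
  move: w wK; apply: span_min => w [b bS wb]; apply/(mem_T0W_lift K wb).
  by rewrite inE in bS.
have [f wf fT] := T0W_rep w; have [wm [wmE ->]] := T0W_decomp wf fT.
have /(mem_T0W_lift K wf) fK := wK.
rewrite big_seq; apply: (rpred_sum (S := mon_span (lift_mon K))) => m mf.
apply: rpredZ; have [mW|mW] := boolP ('X_[m] \in IW).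
  suff -> : wm m = 0 by apply: rpred0.
  by apply: val_inj; rewrite wmE // T0W_val0; apply/proj_eq0.
have [b mb] := T0_bmon (monomial_T0W fT mf) mW; apply: mem_span.
by exists b; [rewrite inE -mb; apply: mK mf|rewrite wmE // mb].
Qed.

Lemma fixed_quot_points_finite : exists (k : nat) (Ks : 'I_k -> submodule T0W),
  forall K n, fixed_quot_point n K -> exists l, K =i Ks l.
Proof.
exists #|{: {set bmon}}|, (fun l => mon_span (enum_val l)) => K n [_ Kt].
by exists (enum_rank (lift_mon K)); rewrite enum_rankK; apply: mon_spanE.
Qed.

Lemma has_length_quot K :
  (forall t, torus t -> forall w, w \in K -> act_T0W t w \in K) ->
  exists n, has_length (quotm K) n.
Proof.
move=> Kt; have mK := T0W_lift_monomial Kt.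
(* The torsion monomials outside the preimage of K will give a basis of the quotient. *)
pose S := [set b : bmon | ('X_[b] \in lift_T 0 IW) && ('X_[b] \notin T0W_lift K)].
have [wm wmP] := choice T0W_X.
pose b (k : 'I_#|S|) : 'X_{1..4} := enum_val k.
have bS k : 'X_[b k] \in lift_T 0 IW /\ 'X_[b k] \notin T0W_lift K.
  by have := enum_valP k; rewrite inE => /andP[].
have b_inj : injective b by move=> k k' /val_inj /enum_val_inj.
exists #|S|, (fun k => proj K (wm (b k))) => x.
have valE (c : 'I_#|S| -> C) : val (\sum_k (c k)%:MP *: wm (b k)) =
    proj IW (\sum_k (c k)%:MP * 'X_[b k]).
  rewrite [LHS](linear_sum (incl _)) [RHS](linear_sum (proj IW)); apply: eq_bigr => k _.
  by rewrite projZ -wmP ?(proj1 (bS k)) //; apply: (linearZ_LR (incl _)).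
have projE (c : 'I_#|S| -> C) : \sum_k (c k)%:MP *: proj K (wm (b k)) =
    proj K (\sum_k (c k)%:MP *: wm (b k)).
  by rewrite linear_sum; apply: eq_bigr => k _; apply/esym/linearZ_LR.
elim/quotm_ind: x => w; have [f wf fT] := T0W_rep w.
have coefE (c : 'I_#|S| -> C) m :
    (\sum_k (c k)%:MP * 'X_[b k])@_m = \sum_(k | b k == m) c k.
  rewrite raddf_sum [RHS]big_mkcond; apply: eq_bigr => k _.
  by rewrite [LHS]mcoeffCM mcoeffX; case: (b k == m); rewrite ?mulr1 ?mulr0.
have coefb (c : 'I_#|S| -> C) k : (\sum_k (c k)%:MP * 'X_[b k])@_(b k) = c k.
  by rewrite coefE (bigD1 k) //= big1 ?addr0 // => k' /andP[/eqP/b_inj ->]; rewrite eqxx.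
(* The preimage of K is monomial and contains every torsion monomial outside S, so only the
   coefficients at S have to match. *)
have key (c : 'I_#|S| -> C) : proj K w = \sum_k (c k)%:MP *: proj K (wm (b k)) <->
    forall k, c k = f@_(b k).
  rewrite projE proj_eq (@mem_T0W_lift _ _ (f - \sum_k (c k)%:MP * 'X_[b k])); last first.
    rewrite -[X in val X]addrC -[X in val (X + _)]scaleN1r T0W_valD valE wf scaleN1r addrC.
    exact/esym/(linearB (proj IW)).
  split=> [fK k|cE].
    apply/eqP; rewrite eq_sym -subr_eq0; apply: contraT => ne.
    case/negP: (proj2 (bS k)); apply: mK fK _.
    by rewrite mcoeff_msupp mcoeffB coefb.
  apply: mem_monomials => m; apply: contraLR => mKN.
  rewrite mcoeff_msupp negbK mcoeffB.
  have [[k km]|nk] := pselect (exists k, b k = m).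
    by rewrite -km coefb cE subrr.
  rewrite coefE big1 ?subr0 => [|k /eqP km]; last by case: nk; exists k.
  rewrite mcoeff_eq0; apply/negP => mf; apply: nk.
  have mT := monomial_T0W fT mf.
  have mW : 'X_[m] \notin IW by apply: contra mKN; apply: sub_W_lift.
  have [b' mb'] := T0_bmon mT mW.
  have b'S : b' \in S by rewrite inE -mb' mT.
  by exists (enum_rank_in b'S b'); rewrite /b enum_rankK_in.
exists [ffun k => f@_(b k)]; split; first by apply/key => k; rewrite ffunE.
by move=> c /key cE; apply/ffunP => k; rewrite ffunE cE.
Qed.

End TorsionSubmodules.

(** * Pairs and submodules *)

Section PairsToSubmodules.
Variable R : realType.
Local Notation C := R[i].
Local Notation A := {mpoly C[4]}.
Variable lam : 'I_4 -> 'I_4 -> diagram.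
Local Notation I123 := (planes_ideal R lam (@Q123)).
Local Notation I4 := (planes_ideal R lam (@Q4)).
Local Notation IW := (W_ideal R lam).
Local Notation T0W := (T0W R lam).
Implicit Types (f g h : A) (i j : 'I_4) (t : 'I_4 -> C) (Q : pair R).

(* Off the origin, y is f' times the section on the first three planes and f''
   times the section on the last three. *)
Definition gluing_exponent Q (y : pair_mod Q) (f' f'' : A) r : Prop :=
  forall i, exists h, [/\ 'X_i ^+ r *: y = h *: pair_sec Q,
    h - 'X_i ^+ r * f' \in I123 & h - 'X_i ^+ r * f'' \in I4].

Definition sec_glues Q (y : pair_mod Q) (f' f'' : A) : Prop :=
  exists r, gluing_exponent y f' f'' r.

Lemma gluing_exponent_le Q (y : pair_mod Q) f' f'' r r' : (r <= r')%N ->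
  gluing_exponent y f' f'' r -> gluing_exponent y f' f'' r'.
Proof.
move=> rr' gy i; have [h [hE h' h'']] := gy i; exists ('X_i ^+ (r' - r) * h).
rewrite -(scalerA ('X_i ^+ (r' - r)) h) -hE (scalerA ('X_i ^+ (r' - r))) -exprD (subnK rr').
have E : 'X_i ^+ r' = 'X_i ^+ (r' - r) * 'X_i ^+ r :> A by rewrite -exprD subnK.
by rewrite E; split; [by []|exact: cech_raise h'|exact: cech_raise h''].
Qed.

Lemma sec_glues_linear Q a (y z : pair_mod Q) f' f'' g' g'' :
  sec_glues y f' f'' -> sec_glues z g' g'' ->
  sec_glues (a *: y + z) (a * f' + g') (a * f'' + g'').
Proof.
move=> [r yr] [r' zr]; pose n := maxn r r'; exists n => i.
have [h [hE h' h'']] := gluing_exponent_le (leq_maxl r r') yr i.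
have [k [kE k' k'']] := gluing_exponent_le (leq_maxr r r') zr i.
exists (a * h + k).
have E (f g : A) : a * h + k - 'X_i ^+ n * (a * f + g) =
    a * (h - 'X_i ^+ n * f) + (k - 'X_i ^+ n * g).
  by rewrite mulrDr opprD addrACA mulrBr mulrCA.
split; [|rewrite E; exact: idealD (idealM a h') k'|rewrite E; exact: idealD (idealM a h'') k''].
by rewrite scalerDr (scaler_swap _ a) hE kE scalerDl scalerA.
Qed.

Lemma sec_glues_sec Q (k : A) : sec_glues (k *: pair_sec Q) k k.
Proof.
by exists 0%N => i; exists k; rewrite expr0 scale1r mul1r subrr !ideal0.
Qed.

Lemma sec_glues0 Q : sec_glues (0 : pair_mod Q) 0 0.
Proof. by have := sec_glues_sec Q 0; rewrite scale0r. Qed.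

Lemma eq_sec_glues Q (y : pair_mod Q) f' f'' g' g'' : f' - g' \in I123 -> f'' - g'' \in I4 ->
  sec_glues y f' f'' -> sec_glues y g' g''.
Proof.
move=> fg' fg'' [r yr]; exists r => i; have [h [hE h' h'']] := yr i; exists h.
have E (f g : A) : h - 'X_i ^+ r * g = h - 'X_i ^+ r * f + 'X_i ^+ r * (f - g).
  by rewrite mulrBr addrA subrK.
split; first by [].
  by rewrite (E f'); apply: idealD => //; apply: idealM.
by rewrite (E f''); apply: idealD => //; apply: idealM.
Qed.

Lemma sec_glues_T0 Q (y : pair_mod Q) f' f'' : sec_glues y f' f'' ->
  f' - f'' \in lift_T 0 IW.
Proof.
move=> [r /choice[h hP]]; apply: (W_ideal_power (r := r) (h := h)) => i.
by case: (hP i).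
Qed.

(** The submodule assigned to Q by the correspondence; it measures how far elements of the module
    are from multiples of the section. *)
Definition gluing_data Q : submodule T0W.
Proof.
apply: (@mk_submodule _ T0W (fun w => exists (y : pair_mod Q) f' f'',
  sec_glues y f' f'' /\ val w = proj IW (f' - f''))).
  by exists 0, 0, 0; split; [exact: sec_glues0|rewrite subrr T0W_val0 linear0].
move=> a w w' [y [f' [f'' [gy wE]]]] [z [g' [g'' [gz wE']]]].
exists (a *: y + z), (a * f' + g'), (a * f'' + g''); split; first exact: sec_glues_linear.
by rewrite T0W_valD wE wE' -projZ -[LHS](linearD (proj IW)) mulrBr opprD addrACA.
Defined.

Lemma mem_gluing_data Q (w : T0W) : (w \in gluing_data Q) <->
  exists (y : pair_mod Q) f' f'', sec_glues y f' f'' /\ val w = proj IW (f' - f'').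
Proof. by rewrite inE; split=> /asboolP. Qed.

Definition fixed_pair_on Q : Prop :=
  [/\ PT0_pair Q, T_fixed Q & pair_supp Q =i planes_ideal R lam (fun _ _ => true)].

Lemma fixed_supp Q f : fixed_pair_on Q -> f *: pair_sec Q = 0 <-> f \in I123 /\ f \in I4.
Proof. by move=> [hQ _ supp]; rewrite -mem_planesT -supp mem_pair_suppE. Qed.

Lemma sec_glues_exists Q (y : pair_mod Q) : fixed_pair_on Q ->
  exists f' f'', sec_glues y f' f''.
Proof.
move=> fQ; have [hQ hT _] := fQ; have [r hr] := coker_power hQ hT.
have /choice[h hE] : forall i, exists h, 'X_i ^+ r *: y = h *: pair_sec Q by move=> i.
have cb i j : 'X_j ^+ r * h i - 'X_i ^+ r * h j \in I123 /\
              'X_j ^+ r * h i - 'X_i ^+ r * h j \in I4.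
  apply/(fixed_supp _ fQ).
  by rewrite scalerBl -(scalerA ('X_j ^+ r)) -(scalerA ('X_i ^+ r)) -!hE scaler_swap subrr.
have [i j|f' f'P] := @H1van_I123 R lam r h; first by case: (cb i j).
have [i j|f'' f''P] := @H1van_I4 R lam r h; first by case: (cb i j).
by exists f', f'', r => i; exists (h i).
Qed.

Lemma sec_glues_of0 Q f' f'' : fixed_pair_on Q -> sec_glues (0 : pair_mod Q) f' f'' ->
  f' \in I123 /\ f'' \in I4.
Proof.
move=> fQ [r gr]; split; apply: (@H0van_planes _ _ _ r) => i;
  have [h [hE h' h'']] := gr i; move: hE; rewrite scaler0 => /esym/(fixed_supp _ fQ)[h3 h4].
- by rewrite -['X_i ^+ r * f'](subKr h); apply: idealB.
- by rewrite -['X_i ^+ r * f''](subKr h); apply: idealB.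
Qed.

(** With [sec_glues_of0], this embeds the module of a fixed pair in the product of the coordinate
    rings of the two halves. *)
Lemma sec_glues_inj Q (y : pair_mod Q) f' f'' : fixed_pair_on Q -> sec_glues y f' f'' ->
  f' \in I123 -> f'' \in I4 -> y = 0.
Proof.
move=> fQ [r gr] f3 f4; have [hQ _ _] := fQ; apply: (PT0_torsion_free hQ (r := r)) => i.
have [h [-> h' h'']] := gr i; apply/(fixed_supp _ fQ); split.
  by rewrite -(subrK ('X_i ^+ r * f') h); apply: idealD => //; apply: idealM.
by rewrite -(subrK ('X_i ^+ r * f'') h); apply: idealD => //; apply: idealM.
Qed.

Lemma sec_glues_act Q t (u : {linear pair_mod Q -> pair_mod Q | twist t \; *:%R})
    (y : pair_mod Q) f' f'' : torus t -> u (pair_sec Q) = pair_sec Q ->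
  sec_glues y f' f'' -> sec_glues (u y) (twist t f') (twist t f'').
Proof.
move=> t0 us [r gr]; exists r => i; have [h [hE h' h'']] := gr i.
pose c : C := torus_inv t i ^+ r; exists (c%:MP * twist t h).
have ct : c%:MP * (t i ^+ r)%:MP = 1 :> A.
  by rewrite -mpolyCM /c /torus_inv -exprMn mulVf // expr1n.
have E f : c%:MP * twist t h - 'X_i ^+ r * twist t f = c%:MP * twist t (h - 'X_i ^+ r * f).
  by rewrite twistB twistM twist_Xn mulrBr -(mulrA (t i ^+ r)%:MP) (mulrA c%:MP) ct mul1r.
split.
- have := congr1 u hE; rewrite !semilinearZ us twist_Xn => e.
  by rewrite -(scalerA c%:MP) -e scalerA mulrA ct mul1r.
- by rewrite E; apply: idealM; apply: monomial_invariant t0 _ h'; apply: monomial_planes.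
- by rewrite E; apply: idealM; apply: monomial_invariant t0 _ h''; apply: monomial_planes.
Qed.

Lemma gluing_data_fixed Q : T_fixed Q ->
  forall t, torus t -> forall w, w \in gluing_data Q -> act_T0W t w \in gluing_data Q.
Proof.
move=> hT t t0 w /mem_gluing_data[y [f' [f'' [gy wE]]]]; have [u [_ us]] := hT t t0.
apply/mem_gluing_data; exists (u y), (twist t f'), (twist t f'').
by split; [exact: sec_glues_act|rewrite (val_act_T0W t0 wE) twistB].
Qed.

Lemma gluing_data_iso Q Q' : pair_iso Q Q' -> gluing_data Q =i gluing_data Q'.
Proof.
move=> [u [[v vK uK] us]].
have uZ a y : u (a *: y) = a *: u y by exact: linearZ.
have glE y f' f'' : sec_glues y f' f'' <-> sec_glues (u y) f' f''.
  split=> -[r gr]; exists r => i; have [h [hE h' h'']] := gr i; exists h; split=> //.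
    by rewrite -uZ hE uZ us.
  by apply: (can_inj vK); rewrite uZ hE uZ us.
move=> w; apply/idP/idP => /mem_gluing_data[y [f' [f'' [gy wE]]]]; apply/mem_gluing_data.
  by exists (u y), f', f''; split=> //; apply/glE.
by exists (v y), f', f''; split=> //; apply/glE; rewrite uK.
Qed.

(** Elements of the two modules correspond when they are glued from the same f' and f''. The
    embedding in the two halves makes partners unique; equality of the gluing data provides them. *)
Lemma pair_iso_of_gluing_data Q Q' : fixed_pair_on Q -> fixed_pair_on Q' ->
  gluing_data Q =i gluing_data Q' -> pair_iso Q Q'.
Proof.
move=> fQ fQ' eK.
have half Q1 Q2 : fixed_pair_on Q1 -> gluing_data Q1 =i gluing_data Q2 ->
    forall y : pair_mod Q1, exists (y' : pair_mod Q2) f' f'',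
      sec_glues y f' f'' /\ sec_glues y' f' f''.
  move=> fQ1 eK12 y; have [f' [f'' gy]] := sec_glues_exists y fQ1.
  have [w wE] := T0W_of (sec_glues_T0 gy).
  have : w \in gluing_data Q1 by apply/mem_gluing_data; exists y, f', f''.
  rewrite eK12 => /mem_gluing_data[z [g' [g'' [gz wE']]]].
  have /proj_eq : proj IW (f' - f'' : A) = proj IW (g' - g'' : A) by rewrite -wE.
  have -> : f' - f'' - (g' - g'') = f' - g' - (f'' - g'') :> A.
    by rewrite !opprD !opprK addrACA.
  (* So far z has only the right difference on W; the discrepancy is a common k on both halves,
     absorbed by adding k times the section. *)
  move=> /glue_one[k [k' k'']].
  exists (k *: pair_sec Q2 + z), f', f''; split=> //.
  have := sec_glues_linear 1 (sec_glues_sec Q2 k) gz; rewrite scale1r !mul1r.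
  by apply: eq_sec_glues; rewrite -idealNE opprB opprD addrA addrAC.
pose P y y' := exists f' f'', sec_glues (y : pair_mod Q) f' f'' /\
  sec_glues (y' : pair_mod Q') f' f''.
have linP : linear_rel P.
  move=> a y y' z z' [f' [f'' [gy gz]]] [g' [g'' [gy' gz']]].
  by exists (a * f' + g'), (a * f'' + g''); split; apply: sec_glues_linear.
have P0 z : P 0 z -> z = 0.
  move=> [f' [f'' [g0 gz]]]; have [f3 f4] := sec_glues_of0 fQ g0.
  exact: sec_glues_inj gz f3 f4.
have [||z [f' [f'' [gz g0]]]|u [bij_u Pu]] := linear_bij_of_rel linP _ P0.
- by move=> y; have [z [f' [f'' [gy gz]]]] := half _ _ fQ eK y; exists z, f', f''.
- move=> z; have [y [f' [f'' [gz gy]]]] := half _ _ fQ' (fun w => esym (eK w)) z.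
  by exists y, f', f''.
- by have [f3 f4] := sec_glues_of0 fQ' g0; apply: sec_glues_inj gz f3 f4.
exists u; split=> //; apply: (linear_rel_inj linP P0 (Pu _)).
by exists 1, 1; split; rewrite -[pair_sec _]scale1r; apply: sec_glues_sec.
Qed.

End PairsToSubmodules.

(** * Fibre products of two quotient rings *)

Section ProductSubmodules.
Variables (A : comNzRingType) (M N : lmodType A) (S : submodule (M * N)%type).
Implicit Types x y : subm S.

Lemma subm_pair_linear1 a x y : (val (a *: x + y)).1 = a *: (val x).1 + (val y).1.
Proof. by []. Qed.

Lemma subm_pair_linear2 a x y : (val (a *: x + y)).2 = a *: (val x).2 + (val y).2.
Proof. by []. Qed.

End ProductSubmodules.

Section FiberProduct.
Variables (A : comNzRingType) (J1 J2 L : ideal A).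
Implicit Types f g h : A.
Local Notation pairs := ((quotm J1 * quotm J2)%type : lmodType A).

(** For L = J1 + J2 this is the image of A; later L is the preimage of a submodule K of T_0(O_W). *)
Definition fiber_product : submodule pairs.
Proof.
apply: (@mk_submodule _ pairs (fun x => exists f' f'',
  [/\ x.1 = proj J1 f', x.2 = proj J2 f'' & f' - f'' \in L])).
  exists 0, 0; split; [exact/esym/(linear0 (proj J1))|exact/esym/(linear0 (proj J2))|].
  by rewrite subrr; exact: ideal0.
move=> a x y [f' [f'' [e1 e2 fL]]] [g' [g'' [d1 d2 gL]]].
exists (a * f' + g'), (a * f'' + g''); split.
- rewrite -[LHS]/(a *: x.1 + y.1) e1 d1; exact/esym/(linearP (proj J1)).
- rewrite -[LHS]/(a *: x.2 + y.2) e2 d2; exact/esym/(linearP (proj J2)).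
rewrite opprD addrACA -mulrBr.
by apply: idealD => //; apply: idealM.
Defined.

Lemma mem_fiber_product (x : pairs) : (x \in fiber_product) <-> exists f' f'',
  [/\ x.1 = proj J1 f', x.2 = proj J2 f'' & f' - f'' \in L].
Proof. by rewrite inE; split=> /asboolP. Qed.

Local Notation F := (subm fiber_product).
Implicit Types x y : F.

Definition coords x f' f'' : Prop := (val x).1 = proj J1 f' /\ (val x).2 = proj J2 f''.

Lemma coords_exists x : exists f' f'', coords x f' f'' /\ f' - f'' \in L.
Proof.
by have /mem_fiber_product[f' [f'' [e1 e2 fL]]] := subm_valP x; exists f', f''.
Qed.

Lemma fiber_of f' f'' : f' - f'' \in L -> exists x, coords x f' f''.
Proof.
move=> fL; have xF : ((proj J1 f', proj J2 f'') : pairs) \in fiber_product.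
  by apply/mem_fiber_product; exists f', f''.
by exists (Subm xF).
Qed.

Lemma fiber_one : ((proj J1 (1 : A), proj J2 (1 : A)) : pairs) \in fiber_product.
Proof. by apply/mem_fiber_product; exists 1, 1; rewrite subrr; split=> //; exact: ideal0. Qed.

Definition fiber_sec : F := Subm fiber_one.

Lemma coords_linear a x y f' f'' g' g'' : coords x f' f'' -> coords y g' g'' ->
  coords (a *: x + y) (a * f' + g') (a * f'' + g'').
Proof.
move=> [e1 e2] [d1 d2]; split.
  rewrite subm_pair_linear1 e1 d1; exact/esym/(linearP (proj J1)).
rewrite subm_pair_linear2 e2 d2; exact/esym/(linearP (proj J2)).
Qed.

Lemma coords0 : coords 0 0 0.
Proof. by split; [exact/esym/(linear0 (proj J1))|exact/esym/(linear0 (proj J2))]. Qed.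

Lemma coordsZ a x f' f'' : coords x f' f'' -> coords (a *: x) (a * f') (a * f'').
Proof.
by move=> ex; have := coords_linear a ex coords0; rewrite !addr0.
Qed.

Lemma coords_sec a : coords (a *: fiber_sec) a a.
Proof. by rewrite -[X in coords _ X]mulr1 -[X in coords _ _ X]mulr1; apply: coordsZ. Qed.

Lemma coords_sum (T : finType) (P : pred T) (c f' f'' : T -> A) (x : T -> F) :
  (forall k, P k -> coords (x k) (f' k) (f'' k)) ->
  coords (\sum_(k | P k) c k *: x k) (\sum_(k | P k) c k * f' k) (\sum_(k | P k) c k * f'' k).
Proof.
move=> h; elim/big_rec3: _ => [|k g'' g' y Pk]; first exact: coords0.
by apply: coords_linear; apply: h.
Qed.

Lemma coords_eq x y f' f'' g' g'' : coords x f' f'' -> coords y g' g'' ->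
  f' - g' \in J1 -> f'' - g'' \in J2 -> x = y.
Proof.
move=> [e1 e2] [d1 d2] /proj_eq e /proj_eq d; apply: val_inj.
move: e1 e2 d1 d2; case: (val x) => ? ?; case: (val y) => ? ? /= -> -> -> ->.
by rewrite e d.
Qed.

Lemma coords_inj x f' f'' g' g'' : coords x f' f'' -> coords x g' g'' ->
  f' - g' \in J1 /\ f'' - g'' \in J2.
Proof.
by move=> [e1 e2] [d1 d2]; split; apply/proj_eq; [rewrite -e1|rewrite -e2].
Qed.

Lemma coords_eq0 x f' f'' : coords x f' f'' -> x = 0 <-> f' \in J1 /\ f'' \in J2.
Proof.
move=> ex; split=> [x0|[f1 f2]]; last by apply: coords_eq ex coords0 _ _; rewrite subr0.
by rewrite x0 in ex; have := coords_inj ex coords0; rewrite !subr0.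
Qed.

Lemma fiber_annihilator f : (forall x, f *: x = 0) <-> f \in J1 /\ f \in J2.
Proof.
split=> [h|[f1 f2] x]; first exact/(coords_eq0 (coords_sec f)).
have [f' [f'' [ex _]]] := coords_exists x.
by apply/(coords_eq0 (coordsZ f ex)); split; rewrite mulrC; apply: idealM.
Qed.

Definition stable (sigma : A -> A) (J : {pred A}) : Prop :=
  forall f, f \in J -> sigma f \in J.

Lemma fiber_semilinear (sigma : {rmorphism A -> A}) :
  stable sigma J1 -> stable sigma J2 -> stable sigma L ->
  exists u : {linear F -> F | sigma \; *:%R},
    forall x f' f'', coords x f' f'' -> coords (u x) (sigma f') (sigma f'').
Proof.
move=> s1 s2 sL; have /choice[u uP] : forall x, exists y, exists f' f'',
    coords x f' f'' /\ coords y (sigma f') (sigma f'').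
  move=> x; have [f' [f'' [ex fL]]] := coords_exists x.
  have [|y ey] := @fiber_of (sigma f') (sigma f''); last by exists y, f', f''.
  by rewrite -rmorphB; apply: sL.
have uE x f' f'' : coords x f' f'' -> coords (u x) (sigma f') (sigma f'').
  move=> ex; have [g' [g'' [dx [d1 d2]]]] := uP x; have [i1 i2] := coords_inj dx ex.
  split; [rewrite d1|rewrite d2]; apply/proj_eq.
    by have := s1 _ i1; rewrite rmorphB.
  by have := s2 _ i2; rewrite rmorphB.
have lin : linear_for (sigma \; *:%R) u.
  move=> a x y; have [f' [f'' [ex _]]] := coords_exists x.
  have [g' [g'' [ey _]]] := coords_exists y.
  have := uE _ _ _ (coords_linear a ex ey); rewrite !rmorphD !rmorphM => e1.
  have e2 := coords_linear (sigma a) (uE _ _ _ ex) (uE _ _ _ ey).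
  by apply: coords_eq e1 e2 _ _; rewrite subrr; apply: ideal0.
pose U : {linear F -> F | sigma \; *:%R} :=
  HB.pack u (GRing.isLinear.Build A F F (sigma \; *:%R) u lin).
by exists U.
Qed.

Lemma fiber_automorphism (sigma tau : {rmorphism A -> A}) :
  cancel sigma tau -> cancel tau sigma ->
  stable sigma J1 -> stable sigma J2 -> stable sigma L ->
  stable tau J1 -> stable tau J2 -> stable tau L ->
  exists u : {linear F -> F | sigma \; *:%R}, bijective u /\ u fiber_sec = fiber_sec.
Proof.
move=> sK tK s1 s2 sL t1 t2 tL.
have [u uP] := fiber_semilinear s1 s2 sL; have [v vP] := fiber_semilinear t1 t2 tL.
have eqF x y f' f'' : coords x f' f'' -> coords y f' f'' -> x = y.
  by move=> ex ey; apply: coords_eq ex ey _ _; rewrite subrr; apply: ideal0.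
exists u; split.
  exists v => x; have [f' [f'' [ex _]]] := coords_exists x; apply: (eqF _ _ f' f'' _ ex).
    by rewrite -(sK f') -(sK f''); apply/vP/uP.
  by rewrite -(tK f') -(tK f''); apply/uP/vP.
have e1 : coords fiber_sec 1 1 by [].
by have := uP _ _ _ e1; rewrite rmorph1 => e2; apply: eqF e2 e1.
Qed.

End FiberProduct.

(** * The pair attached to a submodule of T_0(O_W) *)

Section SubmodulesToPairs.
Variable R : realType.
Local Notation C := R[i].
Local Notation A := {mpoly C[4]}.
Variable lam : 'I_4 -> 'I_4 -> diagram.
Local Notation I123 := (planes_ideal R lam (@Q123)).
Local Notation I4 := (planes_ideal R lam (@Q4)).
Local Notation IW := (W_ideal R lam).
Local Notation T0W := (T0W R lam).
Implicit Types (f g h : A) (i j : 'I_4) (t : 'I_4 -> C) (w : T0W).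
Variable K : submodule T0W.
Local Notation LK := (T0W_lift K).
Local Notation FK := (subm (fiber_product I123 I4 LK)).

Definition fiber_pair : pair R := Pair (fiber_sec I123 I4 LK).

Lemma fiber_supp : pair_supp fiber_pair =i planes_ideal R lam (fun _ _ => true).
Proof.
move=> f; apply/idP/idP => [/mem_pair_supp|/mem_planesT] h.
  by apply/mem_planesT; apply/(@fiber_annihilator _ I123 I4 LK).
by apply/mem_pair_supp; apply/(@fiber_annihilator _ I123 I4 LK).
Qed.

(** Both coordinates of x are 0-dimensional torsion on a union of planes, which has none. *)
Lemma fiber_pure (N : submodule FK) : sub_dim_le N 0 -> forall x, x \in N -> x = 0.
Proof.
move=> dN x /(sub_T_ dN)/mem_T_ dx; have [f' [f'' [ex _]]] := coords_exists x.
have T0 (J : ideal A) f : monomial J -> H0van J ->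
    (forall g, g *: x = 0 -> g * f \in J) -> f \in J.
  move=> mJ HJ h; apply: (H0van_lift_T0 mJ HJ); apply/mem_lift_TP.
  by apply: dim_leS dx => g; rewrite !inE => /eqP/h.
apply/(coords_eq0 ex); split; apply: T0.
- exact: monomial_planes.
- exact: H0van_planes.
- by move=> g /(coords_eq0 (coordsZ g ex))[].
- exact: monomial_planes.
- exact: H0van_planes.
- by move=> g /(coords_eq0 (coordsZ g ex))[].
Qed.

(** For N = [W_bound lam], x_i^N (f' - f'') vanishes on W, so x_i^N times an element is a multiple
    of the section. *)
Lemma fiber_coker : mod_dim_le (quotm (cyclic (pair_sec fiber_pair))) 0.
Proof.
apply: (@dim_le0_powers _ _ _ (W_bound lam)) => i; apply/mem_coker_supp => x.
have [f' [f'' [ex /lift_sub_T0 fT]]] := coords_exists x.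
have := T0_power i fT; rewrite mulrBr => /glue_one[k [k' k'']]; exists k.
exact: coords_eq (coordsZ ('X_i ^+ W_bound lam) ex) (coords_sec _ _ _ k) k' k''.
Qed.

Lemma gluing_data_fiber : gluing_data lam fiber_pair =i K.
Proof.
move=> w; apply/idP/idP => [/mem_gluing_data[x [g' [g'' [[r gr] wE]]]]|wK].
  (* The coordinates of x agree with g' and g'' on each half by [H0van_planes], so the two
     differences agree on W. *)
  apply/(mem_T0W_lift K wE); have [f' [f'' [ex fK]]] := coords_exists x.
  have hi i h : 'X_i ^+ r *: x = h *: pair_sec fiber_pair ->
      'X_i ^+ r * f' - h \in I123 /\ 'X_i ^+ r * f'' - h \in I4.
    move=> hE; have := coordsZ ('X_i ^+ r) ex; rewrite [_ *: x]hE => e.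
    exact: coords_inj e (coords_sec _ _ _ h).
  have d1 : f' - g' \in I123.
    apply: (@H0van_planes _ _ _ r) => i; have [h [/hi[h1 _] h' _]] := gr i.
    by rewrite mulrBr -(subrKA h); apply: idealD h'.
  have d2 : f'' - g'' \in I4.
    apply: (@H0van_planes _ _ _ r) => i; have [h [/hi[_ h2] _ h'']] := gr i.
    by rewrite mulrBr -(subrKA h); apply: idealD h''.
  have -> : g' - g'' = f' - f'' - (f' - g' - (f'' - g'')) :> A.
    have e : f' - g' - (f'' - g'') = f' - f'' - (g' - g'') :> A.
      by rewrite !opprD !opprK addrACA.
    by rewrite e subKr.
  apply: idealB => //; apply: sub_W_lift; apply/mem_sum_ideal.
  by exists (f' - g'), (- (f'' - g'')); rewrite idealNE.
have [f wf fT] := T0W_rep w; have /(mem_T0W_lift K wf) fK := wK.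
(* Conversely, f is the difference of the element with coordinates f and 0. *)
have [|x ex] := @fiber_of _ I123 I4 LK f 0; first by rewrite subr0.
apply/mem_gluing_data; exists x, f, 0; rewrite subr0; split=> //.
exists (W_bound lam) => i; have := T0_power i fT.
rewrite -[X in X \in _]subr0 => /glue_one[h [h' h'']]; exists h; split.
- apply: coords_eq (coordsZ ('X_i ^+ W_bound lam) ex) (coords_sec _ _ _ h) h' _.
  by rewrite mulr0.
- by rewrite -idealNE opprB.
- by rewrite mulr0 subr0 -idealNE -[- h]add0r.
Qed.

Hypothesis Kt : forall t, torus t -> forall w, w \in K -> act_T0W t w \in K.

Lemma fiber_fixed : T_fixed fiber_pair.
Proof.
have st Q' t : torus t -> stable (twist t) (planes_ideal R lam Q').
  by move=> t0 f; apply: (monomial_invariant _ t0); apply: monomial_planes.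
have sK t : torus t -> stable (twist t) LK.
  by move=> t0 f; apply: (monomial_invariant _ t0); apply: T0W_lift_monomial.
move=> t t0; have t'0 := torus_invP t0.
have tK : cancel (twist t) (twist (torus_inv t)).
  by apply: rescaleK => i; rewrite /torus_inv mulVf.
have [u [bij_u us]] := @fiber_automorphism _ I123 I4 LK (twist t) (twist (torus_inv t))
  tK (twistK t0) (st _ _ t0) (st _ _ t0) (sK _ t0) (st _ _ t'0) (st _ _ t'0) (sK _ t'0).
by exists u.
Qed.

End SubmodulesToPairs.

(** * Finite generation of the fibre product *)

Lemma monomial_part (n : nat) (K : fieldType) (T : finType) (b : T -> 'X_{1..n}) (S : {set T})
    (f : {mpoly K[n]}) m : injective b ->
  (f - \sum_(k in S) (f@_(b k))%:MP * 'X_[b k])@_m =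
  if [exists k in S, b k == m] then 0 else f@_m.
Proof.
move=> b_inj; rewrite mcoeffB raddf_sum /=.
case: ifPn => [/existsP[k /andP[kS /eqP <-]]|/existsPn nk].
  rewrite (bigD1 k) //= big1 => [|k' /andP[_ k'k]]; rewrite mcoeffCM mcoeffX.
    by rewrite eqxx mulr1 addr0 subrr.
  by rewrite (inj_eq b_inj) (negbTE k'k) mulr0.
rewrite big1 ?subr0 // => k kS; rewrite mcoeffCM mcoeffX.
by have := nk k; rewrite kS /= => /negbTE ->; rewrite mulr0.
Qed.

Lemma fingen_family (A : comNzRingType) (M : lmodType A) (T : finType) (P : pred T)
    (s : M) (e : T -> M) :
  (forall x, exists a (c : T -> A), x = a *: s + \sum_(k | P k) c k *: e k) -> fingen M.
Proof.
move=> h; pose e' (o : option T) := if o is Some k then e k else s.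
exists #|{: option T}|, (fun k => e' (enum_val k)) => x; have [a [c ->]] := h x.
pose c' (o : option T) := if o is Some k then (if P k then c k else 0) else a.
exists (fun k => c' (enum_val k)).
rewrite -(big_enum_val (A := {: option T}) (fun o => c' o *: e' o)) /=.
rewrite (bigD1 None) //=; congr (_ + _).
rewrite big_mkcond /= (reindex_omap Some id) /=; last by case.
apply: eq_big => [k|k _]; first by rewrite eqxx.
by case: (P k); rewrite ?scale0r.
Qed.

Section FiberFingen.
Variable R : realType.
Local Notation C := R[i].
Local Notation A := {mpoly C[4]}.
Variable lam : 'I_4 -> 'I_4 -> diagram.
Local Notation I123 := (planes_ideal R lam (@Q123)).
Local Notation I4 := (planes_ideal R lam (@Q4)).
Local Notation IW := (W_ideal R lam).
Variable K : submodule (T0W R lam).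
Local Notation LK := (T0W_lift K).
Local Notation FK := (subm (fiber_product I123 I4 LK)).
Hypothesis Kt : forall t, torus t -> forall w, w \in K -> act_T0W t w \in K.

(** Generators are (1, 1) and the (x^b, 0) for the monomials x^b of bounded degree in the preimage
    of K. *)
Lemma fiber_fingen : fingen FK.
Proof.
have mK := T0W_lift_monomial Kt; pose bmon := 'X_{1..4 < (4 * W_bound lam).+1}.
have /choice[e eP] : forall b : bmon, exists x : FK, b \in lift_mon K -> coords x 'X_[b] 0.
  move=> b; have [bK|_] := boolP (b \in lift_mon K); last by exists 0.
  have [|x ex] := @fiber_of _ I123 I4 LK 'X_[b] 0; last by exists x.
  by rewrite subr0; rewrite inE in bK.
apply: (@fingen_family _ _ _ (mem (lift_mon K)) (fiber_sec I123 I4 LK) e) => x.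
have [f' [f'' [ex fK]]] := coords_exists x.
pose c (b : bmon) : A := ((f' - f'')@_b)%:MP.
pose g : A := \sum_(b in lift_mon K) c b * 'X_[b].
(* The monomials left in the difference are in the preimage of K but of unbounded type, hence in the
   ideal of W; what remains is a multiple of (1, 1). *)
have : f' - g - f'' \in IW.
  rewrite addrAC; apply: mem_monomials => m; rewrite mcoeff_msupp.
  rewrite (monomial_part (b := fun b : bmon => b : 'X_{1..4})); last exact: val_inj.
  case: existsP => [_|nb]; first by rewrite eqxx.
  rewrite -mcoeff_msupp => mf; have mLK := mK _ _ fK mf; apply: contraT => mW.
  have [b mb] := T0_bmon (lift_sub_T0 mLK) mW; case: nb; exists b.
  by rewrite inE -mb mLK eqxx.
move=> /glue_one[k [k' k'']]; exists k, c.
have es := coords_sum c eP; have := coords_linear 1 (coords_sec I123 I4 LK k) es.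
rewrite scale1r !mul1r => ey; apply: coords_eq ex ey _ _.
  by rewrite opprD addrA addrAC.
by rewrite big1 ?addr0 // => b _; rewrite mulr0.
Qed.

End FiberFingen.

Theorem theorem1p4 (R : realType) (P : pair R)
    (lam : 'I_4 -> 'I_4 -> diagram)
    (hP : PT0_pair P) (hT : T_fixed P)
    (hlam : pure_part (pair_supp P) =i planes_ideal R lam (fun _ _ => true)) :
  let I := pair_supp P in
  let m := quot_pow_fil I (@origin R) in
  (short_exact (limhom_map m (incl (T_ 1 (quotm I))))
               (limhom_map m (proj (T_ 1 (quotm I)))) /\
   exists Theta : {linear limHom_mod I -> T0W R lam},
     bijective Theta /\
     forall t, torus t -> forall x,
       Theta (act_limHom_mod t x) = act_T0W t (Theta x)) /\
  (I =i pure_part I ->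
   (exists Phi : pair R -> submodule (T0W R lam),
      let fixed_pair Q := [/\ PT0_pair Q, T_fixed Q & pair_supp Q =i I] in
      [/\ forall Q, fixed_pair Q -> exists n, fixed_quot_point n (Phi Q),
          forall Q Q', fixed_pair Q -> fixed_pair Q' ->
            (pair_iso Q Q' <-> Phi Q =i Phi Q')
        & forall K n, fixed_quot_point n K ->
            exists2 Q, fixed_pair Q & Phi Q =i K]) /\
   (exists (k : nat) (Ks : 'I_k -> submodule (T0W R lam)),
      forall K n, fixed_quot_point n K -> exists i, K =i Ks i)).

Proof.
move=> I m; have mI := pair_supp_monomial hT; have hI := pair_supp_H0van hP.
split; first split.
- apply: limhom_exact; first exact: torsion_free_quotm.
    exact: torsion_free_O_Z1 hlam.
  move=> x i j; have [f ->] := projP x => /mem_lift_T/(lift_T1_kill mI)kill ij.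
  by have [r fI] := kill i j ij; exists r; rewrite -projZ; apply/proj_eq0.
- exact: theta_exists.
move=> eI; have eJ : pair_supp P =i planes_ideal R lam (fun _ _ => true).
  by move=> f; rewrite -hlam; apply: eI.
split; last exact: fixed_quot_points_finite.
have fixedE Q : [/\ PT0_pair Q, T_fixed Q & pair_supp Q =i I] -> fixed_pair_on lam Q.
  by move=> [hQ tQ sQ]; split=> // f; rewrite sQ; apply: eJ.
exists (gluing_data lam); split=> [Q [hQ tQ sQ]|Q Q' /fixedE fQ /fixedE fQ'|K n [_ Kt]].
- have Kt := @gluing_data_fixed _ lam _ tQ; have [n len] := has_length_quot Kt.
  by exists n.
- split; [exact: gluing_data_iso|exact: pair_iso_of_gluing_data fQ fQ'].
exists (fiber_pair K); last exact: gluing_data_fiber.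
have supp : pair_supp (fiber_pair K) =i I by move=> f; rewrite fiber_supp -eJ.
(* Dimension depends only on the annihilator, so the new pair inherits dimension 2 from P. *)
have dimE d : mod_dim_le (pair_mod (fiber_pair K)) d <-> mod_dim_le (pair_mod P) d.
  by split; apply: eq_dim_le => f; [exact: supp|exact/esym/supp].
have [d2 d1] := PT0_dim2 hP.
split; [split|exact: fiber_fixed|exact: supp].
- exact: fiber_fingen.
- by split; [apply/dimE|move/dimE].
- exact: fiber_pure.
- exact: fiber_coker.
Qed.
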